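(* Let $\mathfrak c\supseteq\mathfrak a_{\mathfrak q}$, $\mathfrak c_0$, $U_1,\dots,U_r$, $\mathbf D=\mathbb C[D_1,\dots,D_r]\subseteq Z(\mathfrak g)$, $\gamma$ and $\chi_\lambda$ be as described in the context. For every $\lambda\in(\mathfrak a_{\mathfrak q})_{\mathbb C}^*$ and every finite-dimensional irreducible unitary representation $\xi$ of $M$, with infinitesimal character $\Lambda_\xi\in(\mathfrak c_0)^*_{\mathbb C}$, there exists $\lambda(\xi)\in(\mathfrak a_{\mathfrak q})^*_{\mathbb C}$ such that $$\gamma(Z)\bigl(\Lambda_\xi+\lambda(\xi)\bigr)=\chi_\lambda(Z)\qquad\text{for all } Z\in\mathbf D=\mathbb C[D_1,\dots,D_r].$$
   Context: Setting. $G$ is a connected real semisimple Lie group with finite center and Lie algebra $\mathfrak g$; $\sigma$ is an involution of $G$, $H$ is an open subgroup of the fixed point group $G^\sigma$, and $\theta$ is a Cartan involution commuting with $\sigma$ with associated maximal compact subgroup $K$. Write $\mathfrak g=\mathfrak k\oplus\mathfrak p=\mathfrak h\oplus\mathfrak q$ for the $\pm1$-eigenspace decompositions of $\theta$ and $\sigma$. Let $\mathfrak a_{\mathfrak q}$ be a maximal abelian subspace of $\mathfrak p\cap\mathfrak q$, $r=\dim\mathfrak a_{\mathfrak q}$, and let $\mathfrak c\supseteq\mathfrak a_{\mathfrak q}$ be a Cartan subalgebra of $\mathfrak g$, $n=\dim\mathfrak c$. Let $\mathfrak c_0$ be the orthogonal complement of $\mathfrak a_{\mathfrak q}$ in $\mathfrak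 c$ for the Killing form, so $\mathfrak c=\mathfrak c_0\oplus\mathfrak a_{\mathfrak q}$ and $\mathfrak c_{\mathbb C}^*=(\mathfrak c_0)_{\mathbb C}^*\oplus(\mathfrak a_{\mathfrak q})_{\mathbb C}^*$. Points of $\mathfrak c^*_{\mathbb C}$ are written $(t;x)$ with $t\in(\mathfrak c_0)^*_{\mathbb C}$, $x\in(\mathfrak a_{\mathfrak q})^*_{\mathbb C}$. The symmetric algebras $S(\mathfrak c)$, $S(\mathfrak a_{\mathfrak q})$ (complex coefficients) are regarded as algebras of polynomial functions on $\mathfrak c_{\mathbb C}^*$, $(\mathfrak a_{\mathfrak q})_{\mathbb C}^*$. Put $I(\mathfrak c)=S(\mathfrak c)^{W(\mathfrak c)}$, where $W(\mathfrak c)$ is the Weyl group of $(\mathfrak g_{\mathbb C},\mathfrak c_{\mathbb C})$, and $I(\mathfrak a_{\mathfrak q})=S(\mathfrak a_{\mathfrak q})^{W(\mathfrak a_{\mathfrak q})}$, where $W(\mathfrak a_{\mathfrak q})=N_K(\mathfrak a_{\mathfrak q})/Z_K(\mathfrak a_{\mathfrak q})$ is the Weyl group of the restricted root system $\Sigma(\mathfrak g,\mathfrak a_{\mathfrak q})$. $U_1,\dots,U_r\in I(\mathfrak c)$ are homogeneous polynomials such that the restrictions $W_i(x)=U_i(0;x)$, $i=1,\dots,r$, are algebraically independent and $I(\mathfrak a_{\mathfrak q})$ is a free module of finite rank over $\mathbb C[W_1,\dots,W_r]$. $Z(\mathfrak g)$ is the center of the universal enveloping algebra of $\mathfrak g_{\mathbb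 C}$ and $\gamma:Z(\mathfrak g)\to I(\mathfrak c)$ is the Harish-Chandra isomorphism. $D_i\in Z(\mathfrak g)$ is the element with $\gamma(D_i)=U_i$, and $\mathbf D=\mathbb C[D_1,\dots,D_r]$. For $\lambda\in(\mathfrak a_{\mathfrak q})^*_{\mathbb C}$ the character $\chi_\lambda:\mathbf D\to\mathbb C$ is the algebra homomorphism with $\chi_\lambda(D_i)=U_i(0;\lambda)$, $i=1,\dots,r$. $M$ is the reductive group with $Z_G(\mathfrak a_{\mathfrak q})=M\exp(\mathfrak a_{\mathfrak q})$ whose Lie algebra $\mathfrak m$ is the orthogonal complement of $\mathfrak a_{\mathfrak q}$ in the centralizer of $\mathfrak a_{\mathfrak q}$ in $\mathfrak g$; $\mathfrak c_0$ is a Cartan subalgebra of $\mathfrak m$, and the infinitesimal character of $\xi$ is represented by an element $\Lambda_\xi\in(\mathfrak c_0)_{\mathbb C}^*$. *)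

(* Defs.v *)
From HB Require Import structures.
From mathcomp Require Import all_boot all_order all_algebra.
From mathcomp Require Import complex mpoly.
From mathcomp Require Import all_classical reals topology normedtype derive.

Set Implicit Arguments.
Unset Strict Implicit.
Unset Printing Implicit Defensive.

Import Order.TTheory GRing.Theory Num.Theory.
Import numFieldNormedType.Exports.

Local Open Scope classical_set_scope.
Local Open Scope ring_scope.
Local Open Scope complex_scope.

(* An N-dimensional real Lie algebra is carried by 'rV[R]_N (a basis is fixed,
   nothing else); this provides its topology as a finite-dimensional space. *)

Section LieAlgebra.
Variables (R : realType) (N : nat).
Notation g := 'rV[R]_N.
Variable br : g -> g -> g.

Record lie_bracket : Prop := LieBracket {
  lie_linear : forall a x y z, br (a *: x + y) z = a *: br x z + br y z;
  lie_alternating : forall x, br x x = 0;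
  lie_jacobi : forall x y z, br x (br y z) + br y (br z x) + br z (br x y) = 0
}.

Definition lie_abelian (V : {vspace g}) : Prop :=
  forall x y, x \in V -> y \in V -> br x y = 0.

Definition lie_ideal (V : {vspace g}) : Prop :=
  forall x y, y \in V -> br x y \in V.

Definition lie_semisimple : Prop :=
  forall V, lie_ideal V -> lie_abelian V -> V = 0%VS.

Definition lie_automorphism (f : g -> g) : Prop :=
  [/\ linear f, bijective f & forall x y, f (br x y) = br (f x) (f y)].

Definition bracket_space (V W : {vspace g}) : {vspace g} :=
  <<[seq br x y | x <- vbasis V, y <- vbasis W]>>%VS.

Definition lie_nilpotent (V : {vspace g}) : Prop :=
  exists k, iter k (bracket_space V) V = 0%VS.

Definition cartan_subalgebra (c : {vspace g}) : Prop :=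
  [/\ forall x y, x \in c -> y \in c -> br x y \in c,
      lie_nilpotent c
    & forall x, (forall y, y \in c -> br x y \in c) -> x \in c].

Definition killing (x y : g) : R := \tr (lin1_mx (fun z => br x (br y z))).

Definition killing_orthogonal (V : {vspace g}) (x : g) : Prop :=
  forall y, y \in V -> killing x y = 0.

End LieAlgebra.

(* The complex dual of V is 'rV_(\dim V): the functional l is given by its
   values on vbasis V.  Accordingly S(V), with complex coefficients, is
   {mpoly R[i][\dim V]}, where 'X_i stands for the i-th vector of vbasis V. *)

Section Dual.
Variables (R : realType) (N : nat).
Notation g := 'rV[R]_N.

Definition dualC (V : {vspace g}) := 'rV[R[i]]_(\dim V).
Definition SymC (V : {vspace g}) := {mpoly R[i][\dim V]}.

Definition dual_ev (V : {vspace g}) (l : dualC V) (x : g) : R[i] :=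
  \sum_(i < \dim V) (coord (vbasis V) i x)%:C * l ord0 i.

Definition sym_ev (V : {vspace g}) (P : SymC V) (l : dualC V) : R[i] :=
  P.@[fun i => l ord0 i].

(* The point (t;x) of the dual of c, when c is the direct sum of V and W. *)
Definition dual_join (c V W : {vspace g}) (t : dualC V) (x : dualC W)
    : dualC c :=
  \row_(i < \dim c) (dual_ev t (daddv_pi V W (vbasis c)`_i)
                     + dual_ev x (daddv_pi W V (vbasis c)`_i)).

Definition weyl_invariant (V : {vspace g}) (W : (dualC V -> dualC V) -> Prop)
    (P : SymC V) : Prop :=
  forall w l, W w -> sym_ev P (w l) = sym_ev P l.

End Dual.

Section Polynomials.
Variables (R : realType) (k r : nat).

Definition alg_independent (W : 'I_r -> {mpoly R[i][k]}) : Prop :=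
  forall q : {mpoly R[i][r]}, q \mPo [tuple W i | i < r] = 0 -> q = 0.

Definition free_of_finite_rank_over (I : {mpoly R[i][k]} -> Prop)
    (W : 'I_r -> {mpoly R[i][k]}) : Prop :=
  exists (s : nat) (e : 'I_s -> {mpoly R[i][k]}),
    (forall P, I P <-> exists q : 'I_s -> {mpoly R[i][r]},
       P = \sum_(j < s) (q j \mPo [tuple W i | i < r]) * e j) /\
    (forall q : 'I_s -> {mpoly R[i][r]},
       \sum_(j < s) (q j \mPo [tuple W i | i < r]) * e j = 0 ->
       forall j, q j \mPo [tuple W i | i < r] = 0).

End Polynomials.

(* L is a subalgebra of g, reductive in g, and c a Cartan subalgebra of L on
   which the Killing form of g is nondegenerate. *)

Section Roots.
Variables (R : realType) (N : nat).
Notation g := 'rV[R]_N.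
Variables (br : g -> g -> g) (L c : {vspace g}).

(* x + i y, in the complexification of L, has weight a: the condition
   [h, x + i y] = a(h) (x + i y) is split into real and imaginary parts. *)
Definition root_vector (a : dualC c) (x y : g) : Prop :=
  [/\ x \in L, y \in L & forall h, h \in c ->
    br h x = complex.Re (dual_ev a h) *: x - complex.Im (dual_ev a h) *: y /\
    br h y = complex.Im (dual_ev a h) *: x + complex.Re (dual_ev a h) *: y].

Definition is_root (a : dualC c) : Prop :=
  a <> 0 /\ exists x y, (x, y) <> (0, 0) /\ root_vector a x y.

Definition gram : 'M[R[i]]_(\dim c) :=
  \matrix_(i, j) (killing br (vbasis c)`_i (vbasis c)`_j)%:C.

Definition dual_form (a b : dualC c) : R[i] :=
  (a *m invmx gram *m b^T) ord0 ord0.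

Definition reflection (a l : dualC c) : dualC c :=
  l - (2 * dual_form l a / dual_form a a) *: a.

Inductive weyl_group : (dualC c -> dualC c) -> Prop :=
| weyl_id : weyl_group id
| weyl_reflection a w :
    is_root a -> weyl_group w -> weyl_group (fun l => reflection a (w l)).

Record positive_system (pos : seq (dualC c)) : Prop := PositiveSystem {
  pos_uniq : uniq pos;
  pos_root : forall a, a \in pos -> is_root a;
  pos_exclusive : forall a, a \in pos -> - a \notin pos;
  pos_total : forall a, is_root a -> (a \in pos) || (- a \in pos);
  pos_closed : forall a b, a \in pos -> b \in pos -> is_root (a + b) ->
    a + b \in pos
}.

Definition rho (pos : seq (dualC c)) : dualC c := 2^-1 *: \sum_(a <- pos) a.

End Roots.

Section Enveloping.
Variables (R : realType) (N : nat).
Notation g := 'rV[R]_N.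
Variables (br : g -> g -> g) (L : {vspace g}).

Definition lie_morphism_to (A : algType R[i]) (f : g -> A) : Prop :=
  (forall a x y, x \in L -> y \in L -> f (a *: x + y) = a%:C *: f x + f y) /\
  (forall x y, x \in L -> y \in L -> f (br x y) = f x * f y - f y * f x).

(* The universal property of the enveloping algebra of the complexification
   of L; iota is only meaningful on L. *)
Definition enveloping_algebra (U : algType R[i]) (iota : g -> U) : Prop :=
  lie_morphism_to iota /\
  forall (A : algType R[i]) (f : g -> A), lie_morphism_to f ->
    exists F : {lrmorphism U -> A},
      (forall x, x \in L -> F (iota x) = f x) /\
      (forall F' : {lrmorphism U -> A},
         (forall x, x \in L -> F' (iota x) = f x) -> F' =1 F).

Variables (U : algType R[i]) (iota : g -> U).

Definition central_element (z : U) : Prop := forall u, z * u = u * z.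

Definition sym_embedding (c : {vspace g}) (P : SymC c) : U :=
  mmap (fun a => a%:A) (fun i => iota (vbasis c)`_i) P.

(* The left ideal of U generated by the positive root vectors. *)
Definition in_U_nplus (c : {vspace g}) (pos : seq (dualC c)) (u : U) : Prop :=
  exists s : seq (U * U),
    u = \sum_(p <- s) p.1 * p.2 /\
    forall p, p \in s -> exists a x y,
      [/\ a \in pos, root_vector br L a x y & p.2 = iota x + 'i *: iota y].

(* gamma, of which only the values on the center matter, is the isomorphism
   from the center of U onto the Weyl group invariants obtained by projecting
   z to S(c) modulo U n^+ and shifting by rho. *)
Record harish_chandra (c : {vspace g}) (pos : seq (dualC c))
    (gamma : U -> SymC c) : Prop := HarishChandra {
  hc_one : gamma 1 = 1;
  hc_linear : forall a z z', central_element z -> central_element z' ->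
    gamma (a *: z + z') = a *: gamma z + gamma z';
  hc_mul : forall z z', central_element z -> central_element z' ->
    gamma (z * z') = gamma z * gamma z';
  hc_inj : forall z z', central_element z -> central_element z' ->
    gamma z = gamma z' -> z = z';
  hc_image : forall P, weyl_invariant (weyl_group br L (c := c)) P <->
    exists2 z, central_element z & gamma z = P;
  hc_projection : forall z, central_element z -> exists P : SymC c,
    in_U_nplus pos (z - sym_embedding P) /\
    forall l, sym_ev (gamma z) l = sym_ev P (l - rho pos)
}.

End Enveloping.

Section GeneratedAlgebra.
Variables (R : realType) (U : algType R[i]) (r : nat) (D : 'I_r -> U).

(* Meant for pairwise commuting D i. *)
Definition in_generated (Z : U) : Prop :=
  exists p : {mpoly R[i][r]}, Z = mmap (fun a => a%:A) D p.

Record character_with_values (v : 'I_r -> R[i]) (chi : U -> R[i]) : Prop :=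
  CharacterWithValues {
  chi_one : chi 1 = 1;
  chi_linear : forall a Z Z', in_generated Z -> in_generated Z' ->
    chi (a *: Z + Z') = a * chi Z + chi Z';
  chi_mul : forall Z Z', in_generated Z -> in_generated Z' ->
    chi (Z * Z') = chi Z * chi Z';
  chi_gen : forall i, chi (D i) = v i
}.

End GeneratedAlgebra.

#[short(type="preTopologicalGroupType")]
HB.structure Definition PreTopologicalGroup := {G of Group G & Topological G}.

Section Smooth.
Variables (R : realType) (V W : normedModType R).

Fixpoint of_class (k : nat) (O : set V) (f : V -> W) : Prop :=
  if k is k'.+1 then
    forall v, (forall x, O x -> derivable f x v) /\ of_class k' O ('D_v f)
  else forall x, O x -> {for x, continuous f}.

Definition smooth_on (O : set V) (f : V -> W) : Prop :=
  forall k, of_class k O f.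

End Smooth.

Section LieGroup.
Variables (R : realType) (N : nat).
Notation g := 'rV[R]_N.
Variables (br : g -> g -> g) (G : preTopologicalGroupType).
Variables (exp : g -> G) (Ad : G -> g -> g).

(* G is a Lie group with Lie algebra (g, br), exponential map exp and adjoint
   representation Ad.  The manifold structure is the one given by the left
   translates of the exponential chart; the product, read in that chart near
   (0, 0), is required to be smooth.  Since [x, y] is the derivative at t = 0
   of Ad (exp (t x)) y, the bracket is determined by the group. *)
Record lie_group : Prop := LieGroup {
  lg_bracket : lie_bracket br;
  lg_hausdorff : hausdorff_space G;
  lg_mul_continuous : continuous (fun p : G * G => (p.1 * p.2)%g);
  lg_inv_continuous : continuous (fun x : G => (x^-1)%g);
  lg_one_parameter : forall x (s t : R),
    exp ((s + t) *: x) = (exp (s *: x) * exp (t *: x))%g;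
  lg_chart : exists O : set g,
    [/\ open O, O 0, {in O &, injective exp} &
        forall A, A `<=` O -> (open A <-> open (exp @` A))];
  lg_smooth : exists (O : set (g * g)%type) (mu : g * g -> g),
    [/\ open O, O (0, 0), mu (0, 0) = 0, smooth_on O mu &
        forall p, O p -> exp (mu p) = (exp p.1 * exp p.2)%g];
  lg_Ad_exp : forall x y, (x * exp y * x^-1)%g = exp (Ad x y);
  lg_Ad_automorphism : forall x, lie_automorphism br (Ad x);
  lg_Ad_morphism : forall x y z, Ad (x * y)%g z = Ad x (Ad y z);
  lg_Ad_derivative : forall x y : g,
    is_derive (0 : R) (1 : R) (fun t : R => Ad (exp (t *: x)) y) (br x y)
}.

Definition subgroup (S : set G) : Prop :=
  [/\ S 1%g, forall x y, S x -> S y -> S (x * y)%g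
    & forall x, S x -> S (x^-1)%g].

Definition group_center : set G := [set z | forall x, (z * x = x * z)%g].

Definition fixed_points (s : G -> G) : set G := [set x | s x = x].

(* A smooth involutive automorphism s of G, with differential ds. *)
Record lie_group_involution (s : G -> G) (ds : g -> g) : Prop :=
  LieGroupInvolution {
  inv_morphism : forall x y, s (x * y)%g = (s x * s y)%g;
  inv_involutive : involutive s;
  inv_continuous : continuous s;
  inv_differential : lie_automorphism br ds;
  inv_exp : forall x, s (exp x) = exp (ds x)
}.

Definition cartan_involution (theta : G -> G) (dtheta : g -> g) : Prop :=
  lie_group_involution theta dtheta /\
  forall x, x <> 0 -> 0 < - killing br x (dtheta x).

Definition open_subgroup_of_fixed_points (s : G -> G) (H : set G) : Prop :=
  subgroup H /\ exists2 O : set G, open O & H = O `&` fixed_points s.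

(* Maximality among abelian subspaces of the (-1,-1)-eigenspace. *)
Definition maximal_abelian_in_pq (dtheta dsigma : g -> g) (a : {vspace g})
    : Prop :=
  let in_pq (V : {vspace g}) :=
    forall x, x \in V -> dtheta x = - x /\ dsigma x = - x in
  [/\ in_pq a, lie_abelian br a &
      forall b, in_pq b -> lie_abelian br b -> (a <= b)%VS -> b = a].

(* The action on the complex dual of a of N_K(a) / Z_K(a). *)
Definition weyl_group_of_normalizer (K : set G) (a : {vspace g})
    (w : dualC a -> dualC a) : Prop :=
  exists k, [/\ K k, forall x, x \in a -> Ad k x \in a &
    forall l x, x \in a -> dual_ev (w l) (Ad k x) = dual_ev l x].

Definition group_centralizer (a : {vspace g}) : set G :=
  [set x | forall h, h \in a -> Ad x h = h].

(* The Langlands decomposition Z_G(a) = M exp(a), M x a -> Z_G(a) being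
   bijective, where M is closed with Lie algebra m. *)
Record langlands_factor (a m : {vspace g}) (M : set G) : Prop :=
  LanglandsFactor {
  lf_subgroup : subgroup M;
  lf_closed : closed M;
  lf_decomposition : forall x, group_centralizer a x <->
    exists y h, [/\ M y, h \in a & x = (y * exp h)%g];
  lf_trivial : forall h, h \in a -> M (exp h) -> h = 0;
  lf_lie_algebra : forall x, x \in m <-> forall t : R, M (exp (t *: x))
}.

Record irreducible_unitary_rep (M : set G) (d : nat) (xi : G -> 'M[R[i]]_d)
    : Prop := IrreducibleUnitaryRep {
  rep_one : xi 1%g = 1%:M;
  rep_mul : forall x y, M x -> M y -> xi (x * y)%g = xi x *m xi y;
  rep_unitary : forall x, M x -> xi x \is unitarymx;
  rep_continuous : forall i j,
    {within M, continuous (fun x => complex.Re (xi x i j) : R)} /\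
    {within M, continuous (fun x => complex.Im (xi x i j) : R)};
  rep_nonzero : (0 < d)%N;
  rep_irreducible : forall V : {vspace 'cV[R[i]]_d},
    (forall x v, M x -> v \in V -> xi x *m v \in V) -> V = 0%VS \/ V = fullv
}.

(* dxi is the extension to the enveloping algebra U of m of the differential
   of xi. *)
Record differential_rep (m : {vspace g}) (U : algType R[i]) (iota : g -> U)
    (d : nat) (xi : G -> 'M[R[i]]_d) (dxi : U -> 'M[R[i]]_d) : Prop :=
  DifferentialRep {
  drep_one : dxi 1 = 1%:M;
  drep_linear : forall a u v, dxi (a *: u + v) = a *: dxi u + dxi v;
  drep_mul : forall u v, dxi (u * v) = dxi u *m dxi v;
  drep_derivative : forall x i j, x \in m ->
    is_derive (0 : R) (1 : R)
      (fun t : R => complex.Re (xi (exp (t *: x)) i j) : R)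
      (complex.Re (dxi (iota x) i j)) /\
    is_derive (0 : R) (1 : R)
      (fun t : R => complex.Im (xi (exp (t *: x)) i j) : R)
      (complex.Im (dxi (iota x) i j))
}.

(* The center of U(m) acts through z |-> gamma_m(z)(Lambda). *)
Definition infinitesimal_character (m c0 : {vspace g}) (d : nat)
    (xi : G -> 'M[R[i]]_d) (Lambda : dualC c0) : Prop :=
  exists (U : algType R[i]) (iota : g -> U) (pos : seq (dualC c0))
         (gamma : U -> SymC c0) (dxi : U -> 'M[R[i]]_d),
    [/\ enveloping_algebra br m iota, positive_system br m pos,
        harish_chandra br m iota pos gamma, differential_rep m iota xi dxi &
        forall z, central_element z -> dxi z = (sym_ev (gamma z) Lambda)%:M].

End LieGroup.

(* Main.v *)
Require Import Defs.
From HB Require Import structures.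
From mathcomp Require Import all_boot all_order all_algebra.
From mathcomp Require Import complex mpoly.
From mathcomp Require Import all_classical reals topology normedtype derive.

Set Implicit Arguments.
Unset Strict Implicit.
Unset Printing Implicit Defensive.

Import Order.TTheory GRing.Theory Num.Theory.
Import numFieldNormedType.Exports.

Local Open Scope classical_set_scope.
Local Open Scope ring_scope.
Local Open Scope complex_scope.

(* Put [f_i(x) = U_i(Lambda; x) - U_i(0; lambda)].  Applying [gamma] and [chi]
   to a polynomial in the [D_i] shows that a common zero of the [f_i] is what
   is wanted.  As [U_i] is homogeneous, [f_i] has leading form [W_i].

   The group acting on the dual of [aq] has finite orbits on the coordinate
   functions: each [x_j] is algebraic over [C[W]], and its transforms are roots
   of the same equation because the [W_i] are invariant.  Hence [x_j] is
   integral over the invariants, which are finite over [C[W]], so that a monic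
   polynomial in [x_j] lies in the ideal [(W)]; by homogeneity some power of
   [x_j] does, and reducing degrees modulo the [f_i] makes [C[x]] finite over
   [C[f]].  The [f_i] are algebraically independent because their leading forms
   are, so [(f)] is a proper ideal by Nakayama's argument, and it has a zero
   since [C[x] / (f)] is finite-dimensional. *)

(** * Ideals and their zeros *)

Section Ideals.
Variable A : comNzRingType.

Definition is_ideal (J : A -> Prop) : Prop :=
  [/\ J 0, forall x y, J x -> J y -> J (x + y) & forall a x, J x -> J (a * x)].

Definition generated_ideal (I : finType) (f : I -> A) (x : A) : Prop :=
  exists h : I -> A, x = \sum_i h i * f i.

Lemma generated_ideal_is_ideal (I : finType) (f : I -> A) :
  is_ideal (generated_ideal f).
Proof.
split.
- by exists (fun=> 0); rewrite big1 // => i _; rewrite mul0r.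
- move=> x y [h ->] [k ->]; exists (fun i => h i + k i).
  by rewrite -big_split; apply: eq_bigr => i _; rewrite mulrDl.
- move=> a x [h ->]; exists (fun i => a * h i).
  by rewrite mulr_sumr; apply: eq_bigr => i _; rewrite mulrA.
Qed.

Lemma generated_ideal_gen (I : finType) (f : I -> A) i : generated_ideal f (f i).
Proof.
exists (fun j => (j == i)%:R); rewrite (bigD1 i) //= eqxx mul1r big1 ?addr0 //.
by move=> j /negPf ->; rewrite mul0r.
Qed.

Variables (J : A -> Prop) (idJ : is_ideal J).

Lemma ideal0 : J 0. Proof. by case: idJ. Qed.
Lemma idealD x y : J x -> J y -> J (x + y).
Proof. by case: idJ => _ + _; apply. Qed.
Lemma idealMl a x : J x -> J (a * x).
Proof. by case: idJ => _ _; apply. Qed.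
Lemma idealN x : J x -> J (- x).
Proof. by rewrite -mulN1r; apply: idealMl. Qed.
Lemma idealB x y : J x -> J y -> J (x - y).
Proof. by move=> Jx /idealN; apply: idealD. Qed.
Lemma ideal_sum (I : Type) (s : seq I) (P : pred I) (F : I -> A) :
  (forall i, P i -> J (F i)) -> J (\sum_(i <- s | P i) F i).
Proof. by move=> JF; apply: (big_ind J) => //; [exact: ideal0 | exact: idealD]. Qed.

End Ideals.

Lemma kernel_neq0 (F : fieldType) (p q : nat) (C : 'M[F]_(p, q)) :
  (q < p)%N -> exists2 v : 'rV[F]_p, v != 0 & v *m C = 0.
Proof.
move=> qp; have /rowV0Pn[v vK v0] : kermx C != 0.
  by rewrite -mxrank_eq0 mxrank_ker -lt0n subn_gt0 (leq_ltn_trans (rank_leq_col C)).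
by exists v => //; apply/sub_kermxP.
Qed.

Section AlgebraIdeals.
Variables (F : fieldType) (A : comAlgType F) (J : A -> Prop).
Hypothesis idJ : is_ideal J.

Lemma idealZ a x : J x -> J (a *: x).
Proof. by rewrite -mulr_algl; apply: idealMl. Qed.

(** Modulo [J] all powers of [x] lie in the span of the finite family [m], so the first [#|I| + 1]
    of them are linearly dependent; the relation is then made monic. *)
Lemma ideal_algebraic (I : finType) (m : I -> A) (x : A) :
  (forall k, exists c : I -> F, J (x ^+ k - \sum_i c i *: m i)) ->
  exists2 u : {poly F}, u \is monic & J (horner_alg x u).
Proof.
move=> /choice[c Jc]; set s := #|I|.
have [v v0 vC] := @kernel_neq0 F s.+1 s
  (\matrix_(k, i) c k (enum_val i)) (ltnSn _).
pose u := \poly_(k < s.+1) (v ord0 (inord k)).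
have uE : u = \sum_(k < s.+1) v ord0 k *: 'X^k.
  by rewrite /u poly_def; apply: eq_bigr => k _; rewrite inord_val.
have u0 : u != 0.
  apply: contra v0 => /eqP u0; apply/eqP/rowP => k.
  by rewrite mxE -(coef0 _ k) -u0 coef_poly ltn_ord inord_val.
have Ju : J (horner_alg x u).
  have -> : horner_alg x u =
      \sum_(k < s.+1) v ord0 k *: (x ^+ k - \sum_i c k i *: m i).
    under [RHS]eq_bigr do rewrite scalerBr.
    (* The combination of the [m i] vanishes because [v] kills the matrix of the [c k i]. *)
    rewrite sumrB [X in _ - X](_ : _ = 0) ?subr0.
      rewrite uE linear_sum; apply: eq_bigr => k _ /=.
      by rewrite linearZ /= mulr_algl rmorphXn /= horner_algX.
    under eq_bigr do rewrite scaler_sumr.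
    rewrite exchange_big big1 //= => i _.
    under eq_bigr do rewrite scalerA.
    rewrite -scaler_suml; move/matrixP/(_ ord0 (enum_rank i)): vC.
    rewrite !mxE; under eq_bigr do rewrite mxE enum_rankK.
    by move=> ->; rewrite scale0r.
  by apply: ideal_sum => // k _; apply: idealZ.
exists ((lead_coef u)^-1 *: u).
  by rewrite monicE lead_coefZ mulVf // lead_coef_eq0.
by rewrite linearZ /= mulr_algl; apply: idealZ.
Qed.

End AlgebraIdeals.

Section ZeroOfIdeal.
Variable F : closedFieldType.

(** If every [J + (x - a)] contained [1], each factor [x - a] could be cancelled modulo [J].
    Splitting [u] into linear factors and cancelling them all would put [1] in [J]. *)
Lemma ideal_adjoin_root (A : comAlgType F) (J : A -> Prop) x (u : {poly F}) :
  is_ideal J -> ~ J 1 -> u \is monic -> J (horner_alg x u) ->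
  exists (a : F) (J' : A -> Prop), [/\ is_ideal J', ~ J' 1,
    forall y, J y -> J' y & J' (x - a%:A)].
Proof.
move=> idJ J1 mon_u Ju; apply: contrapT => noroot.
have [s] := closed_field_poly_normal u; rewrite (monicP mon_u) scale1r => us.
(* If [y] is not in [J], then [J + (x - a)] is proper: multiplying [1 = j + b * (x - a)] by [y]
   would give [y] in [J]. *)
have cancel a y : J (y * (x - a%:A)) -> J y.
  move=> Jy; apply: contrapT => nJy; apply: noroot.
  exists a, (fun z => exists j b, J j /\ z = j + b * (x - a%:A)); split.
  - split; first by exists 0, 0; rewrite mul0r addr0; split => //; exact: ideal0.
      move=> _ _ [j [b [Jj ->]]] [j' [b' [Jj' ->]]].
      exists (j + j'), (b + b'); split; first exact: idealD.
      by rewrite mulrDl addrACA.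
    move=> c _ [j [b [Jj ->]]]; exists (c * j), (c * b).
    by split; [exact: idealMl | rewrite mulrDr mulrA].
  - move=> [j [b [Jj e]]]; apply: nJy.
    rewrite -[y]mulr1 e mulrDr; apply: idealD => //; first exact: idealMl.
    by rewrite mulrCA; apply: idealMl.
  - by move=> y' Jy'; exists y', 0; rewrite mul0r addr0.
  - by exists 0, 1; rewrite mul1r add0r; split=> //; exact: ideal0.
have key t y : J (y * \prod_(a <- t) (x - a%:A)) -> J y.
  elim: t y => [|a t IH] y; first by rewrite big_nil mulr1.
  by rewrite big_cons mulrA => /IH /cancel.
apply/J1/(key s); rewrite mul1r.
suff <- : horner_alg x u = \prod_(a <- s) (x - a%:A) by [].
rewrite us rmorph_prod; apply: eq_bigr => a _.
by rewrite rmorphB /= horner_algX horner_algC.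
Qed.

(** The elements are treated one at a time: a monic equation modulo [J] persists modulo any larger
    ideal. *)
Lemma ideal_adjoin_roots (A : comAlgType F) (J : A -> Prop) (s : seq A) :
  is_ideal J -> ~ J 1 ->
  (forall x, x \in s -> exists2 u : {poly F}, u \is monic & J (horner_alg x u)) ->
  exists J' : A -> Prop, [/\ is_ideal J', ~ J' 1, forall y, J y -> J' y &
    forall x, x \in s -> exists a : F, J' (x - a%:A)].
Proof.
move=> idJ J1; elim: s => [|x s IH] alg; first by exists J; split.
have [|J1' [id1 J11 sub1 root1]] := IH.
  by move=> y ys; apply: alg; rewrite in_cons ys orbT.
have [u mon_u /sub1 Ju] := alg x (mem_head _ _).
have [a [J2 [id2 J21 sub2 root2]]] := ideal_adjoin_root id1 J11 mon_u Ju.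
exists J2; split => // [y /sub1 /sub2 //|y]; rewrite in_cons => /orP[/eqP ->|].
  by exists a.
by move=> /root1 [b /sub2]; exists b.
Qed.

(** Enlarge [J] to a proper ideal containing every ['X_j - a j]. Each polynomial is congruent to its
    value at [a], and a nonzero value at an element of [J] would make the ideal improper. *)
Lemma ideal_zero n (J : {mpoly F[n]} -> Prop) :
  is_ideal J -> ~ J 1 ->
  (forall j, exists2 u : {poly F}, u \is monic & J (horner_alg 'X_j u)) ->
  exists a : 'I_n -> F, forall g, J g -> g.@[a] = 0.
Proof.
move=> idJ J1 alg.
have [|J' [idJ' J'1 sub rootJ]] :=
    @ideal_adjoin_roots {mpoly F[n]} J [seq 'X_j | j <- enum 'I_n] idJ J1.
  by move=> x /mapP[j _ ->].
have /choice[a Ja] : forall j : 'I_n, exists a : F, J' ('X_j - a%:A).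
  by move=> j; apply/rootJ/map_f; rewrite mem_enum.
exists a => g /sub J'g.
have Jdiff p : J' (p - (p.@[a])%:A).
  pose K (p : {mpoly F[n]}) := J' (p - (p.@[a])%:A); rewrite -/(K p).
  (* Closure under products reduces the congruence to constants and variables. *)
  have KM q q' : K q -> K q' -> K (q * q').
    move=> Kq Kq'; rewrite /K mevalM -[(_ * _)%:A]scalerA -mulr_algl.
    have -> : q * q' - (q.@[a])%:A * (q'.@[a])%:A =
        q' * (q - (q.@[a])%:A) + (q.@[a])%:A * (q' - (q'.@[a])%:A).
      by rewrite !mulrBr addrA [q' * q]mulrC [q' * _%:A]mulrC subrK.
    by apply: idealD => //; apply: idealMl.
  have K1 : K 1 by rewrite /K meval1 scale1r subrr; apply: ideal0.
  rewrite (mpolyE p); apply: (big_ind K).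
  - by rewrite /K meval0 scale0r subrr; apply: ideal0.
  - move=> q q' Kq Kq'; rewrite /K mevalD scalerDl opprD addrACA.
    exact: idealD.
  - move=> m _; rewrite -mulr_algl; apply: (KM).
      by rewrite /K mevalZ meval1 mulr1 subrr; apply: ideal0.
    rewrite mpolyXE_id; apply: (big_ind K K1 KM) => j _.
    elim: (m j) => [|k IH]; first by rewrite expr0.
    by rewrite exprS; apply: (KM _ _ _ IH); rewrite /K mevalXU.
apply/eqP; apply: contrapT => /negP ga; apply: J'1.
have : J' ((g.@[a])^-1 *: (g - (g - (g.@[a])%:A))).
  by apply: idealZ => //; apply: idealB.
by rewrite opprB addrC subrK scalerA mulVf ?scale1r.
Qed.

End ZeroOfIdeal.

(** * Finite generation of the polynomial ring over a subalgebra *)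

Section FiniteOver.
Variables (F : fieldType) (n r : nat) (t : r.-tuple {mpoly F[n]}).

(** The form of [alg_independent] for tuples over any field; on [[tuple W i | i < r]] both unfold to
    the same proposition. *)
Definition algebraically_independent : Prop :=
  forall q : {mpoly F[r]}, q \mPo t = 0 -> q = 0.

Definition spans_over (I : finType) (m : I -> {mpoly F[n]}) : Prop :=
  forall p, exists q : I -> {mpoly F[r]}, p = \sum_i (q i \mPo t) * m i.

(** A nonconstant monomial evaluated at [t] has some [tnth t i] as a factor, so only the constant
    term survives modulo [J]. *)
Lemma comp_mpoly_mod_ideal (J : {mpoly F[n]} -> Prop) (p : {mpoly F[r]}) :
  is_ideal J -> (forall i, J (tnth t i)) -> J (p \mPo t - (p@_0%MM)%:MP).
Proof.
move=> idJ Jt; pose K (q : {mpoly F[r]}) := J (q \mPo t - (q@_0%MM)%:MP).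
rewrite -/(K p) (mpolyE p); apply: (big_ind K).
- by rewrite /K comp_mpoly0 mcoeff0 mpolyC0 subrr; apply: ideal0.
- move=> q q' Kq Kq'; rewrite /K comp_mpolyD mcoeffD mpolyCD opprD addrACA.
  exact: idealD.
- move=> m _; rewrite /K comp_mpolyZ mcoeffZ mcoeffX.
  have [->|m0] := eqVneq m 0%MM.
    by rewrite mulr1 mpolyX0 comp_mpoly1 alg_mpolyC subrr; apply: ideal0.
  rewrite mulr0 mpolyC0 subr0; apply: idealZ => //.
  have [i mi] : exists i, m i != 0%N.
    apply/existsP; apply: contraR m0 => /existsPn m0.
    by apply/eqP/mnmP => i; rewrite mnm0E; apply/eqP; rewrite -[_ == _]negbK.
  rewrite comp_mpolyX (bigD1 i) //= mulrC.
  by case: (m i) mi => // k _; rewrite exprSr mulrA; apply: idealMl.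
Qed.

(** Modulo the ideal of [t] the coefficients become constants, so the quotient is spanned over [F]
    by the [m i]. *)
Lemma spans_over_algebraic (I : finType) (m : I -> {mpoly F[n]}) :
  spans_over m -> forall x, exists2 u : {poly F},
    u \is monic & generated_ideal (tnth t) (horner_alg x u).
Proof.
move=> span_m x; have idJ := generated_ideal_is_ideal (tnth t).
apply: (ideal_algebraic idJ (m := m)) => k.
have [q ->] := span_m (x ^+ k); exists (fun i => (q i)@_0%MM).
rewrite -sumrB; apply: ideal_sum => // i _.
rewrite -mul_mpolyC -mulrBl mulrC; apply: idealMl => //.
by apply: comp_mpoly_mod_ideal => // j; apply: generated_ideal_gen.
Qed.

(* Nakayama: if [1] were in the ideal generated by [t], multiplication by [1]
   would be given on the [m i] by a matrix [N t], where [N] vanishes at the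
   origin, and [\det (1 - N)] would be an algebraic relation between the
   entries of [t]. *)
Lemma spans_over_proper (I : finType) (m : I -> {mpoly F[n]}) :
  algebraically_independent -> spans_over m ->
  ~ generated_ideal (tnth t) 1.
Proof.
move=> indep span_m [g g1]; pose s := #|I|.
have /choice[q qE] : forall ij : I * 'I_r, exists q : I -> {mpoly F[r]},
    g ij.2 * m ij.1 = \sum_k (q k \mPo t) * m k.
  by move=> ij; apply: span_m.
pose N : 'M[{mpoly F[r]}]_s := \matrix_(a, b)
  \sum_(i < r) 'X_i * q (enum_val a, i) (enum_val b).
pose v : 'cV[{mpoly F[n]}]_s := \col_a m (enum_val a).
have Nv : map_mx (comp_mpoly t) N *m v = v.
  apply/colP => a; rewrite !mxE -[RHS]mul1r g1 mulr_suml.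
  under [RHS]eq_bigr => i _ do
    rewrite mulrAC (qE (enum_val a, i)) mulrC mulr_sumr.
  rewrite exchange_big /= (reindex (@enum_val I I)) /=; last first.
    by exists enum_rank => k _; rewrite ?enum_valK ?enum_rankK.
  apply: eq_bigr => b _; rewrite !mxE rmorph_sum mulr_suml.
  by apply: eq_bigr => i _; rewrite rmorphM /= comp_mpolyXU -tnth_nth mulrA.
pose B := map_mx (comp_mpoly t) (1%:M - N).
(* The adjugate of [B] shows that [\det B] annihilates each generator [m i], hence also [1]. *)
have detv a : \det B * v a ord0 = 0.
  have : (\adj B *m (B *m v)) a ord0 = 0.
    by rewrite /B map_mxB map_mx1 mulmxBl mul1mx Nv subrr mulmx0 mxE.
  by rewrite mulmxA mul_adj_mx mul_scalar_mx mxE.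
have det0 : \det (1%:M - N) = 0.
  apply: indep; rewrite -det_map_mx -/B.
  have [c c1] := span_m 1; rewrite -[LHS]mulr1 c1 mulr_sumr big1 // => i _.
  rewrite mulrCA; move: (detv (enum_rank i)).
  by rewrite mxE enum_rankK => ->; rewrite mulr0.
(* At the origin [N] vanishes and the determinant is [1], a contradiction. *)
have := congr1 (meval (fun=> 0)) det0.
rewrite meval0 -det_map_mx map_mxB map_mx1 (_ : map_mx _ N = 0) ?subr0 ?det1.
  by move/eqP; rewrite oner_eq0.
apply/matrixP => a b; rewrite !mxE /= rmorph_sum big1 // => i _.
by rewrite rmorphM /= mevalXU mul0r.
Qed.

End FiniteOver.

(** * Leading forms *)

Section LeadingForms.
Variables (F : fieldType) (n : nat).
Implicit Types p q w : {mpoly F[n]}.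

(** Since [msize] is the degree plus one, the hypotheses say that [p] has degree at most [a] and [q]
    degree less than [b]. *)
Lemma msizeM_leq p q a b :
  (msize p <= a.+1)%N -> (msize q <= b)%N -> (msize (p * q) <= a + b)%N.
Proof.
have [->|p0] := eqVneq p 0; first by rewrite mul0r msize0.
have [->|q0] := eqVneq q 0; first by rewrite mulr0 msize0.
rewrite msizeM // => pa qb; rewrite -ltnS -addSn.
rewrite prednK ?addn_gt0 ?lt0n ?msize_poly_eq0 ?p0 //.
by rewrite (leq_trans (leq_add pa qb)).
Qed.

Lemma msize_sum_leq (I : Type) (s : seq I) (P : pred I) (G : I -> {mpoly F[n]}) d :
  (forall i, P i -> (msize (G i) <= d)%N) ->
  (msize (\sum_(i <- s | P i) G i) <= d)%N.
Proof.
move=> Gd; apply: (big_ind (fun p => msize p <= d)%N) => //.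
  by rewrite msize0.
by move=> p q pd qd; rewrite (leq_trans (msizeD_le _ _)) // geq_max pd.
Qed.

Lemma dhomog_msize_leq p d : p \is d.-homog -> (msize p <= d.+1)%N.
Proof.
move=> /dhomogP pd; rewrite msizeE; apply/bigmax_leqP_seq => m mp _.
by rewrite ltnS pd.
Qed.

Lemma dhomog_small p d : p \is d.-homog -> (msize p <= d)%N -> p = 0.
Proof.
move=> /dhomogP pd pl; apply/msuppnil0.
case E: (msupp p) => [//|m s].
have mp : m \in msupp p by rewrite E mem_head.
by have := leq_trans (msize_mdeg_lt mp) pl; rewrite -(pd _ mp) ltnn.
Qed.

(** The form [w] may be zero, so products need no condition of nonvanishing. *)
Definition leading_form p w (d : nat) : Prop :=
  w \is d.-homog /\ (msize (p - w) <= d)%N.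

Lemma leading_form_msize p w d : leading_form p w d -> (msize p <= d.+1)%N.
Proof.
move=> [hw pw]; rewrite -[p](subrK w) (leq_trans (msizeD_le _ _)) // geq_max.
by rewrite (leqW pw) dhomog_msize_leq.
Qed.

Lemma leading_form1 : leading_form 1 1 0.
Proof. by split; [exact: dhomog1 | rewrite subrr msize0]. Qed.

Lemma leading_formM p w d p' w' d' :
  leading_form p w d -> leading_form p' w' d' ->
  leading_form (p * p') (w * w') (d + d').
Proof.
move=> lp lp'; have [hw pw] := lp; have [hw' pw'] := lp'.
split; first exact: dhomogM.
have -> : p * p' - w * w' = p' * (p - w) + w * (p' - w').
  by rewrite !mulrBr addrA [p' * p]mulrC [p' * w]mulrC subrK.
rewrite (leq_trans (msizeD_le _ _)) // geq_max; apply/andP; split.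
  by rewrite addnC msizeM_leq // (leading_form_msize lp').
by rewrite msizeM_leq // dhomog_msize_leq.
Qed.

Lemma leading_formX p w d k :
  leading_form p w d -> leading_form (p ^+ k) (w ^+ k) (k * d).
Proof.
move=> lp; elim: k => [|k IH]; first by rewrite mul0n; apply: leading_form1.
by rewrite !exprS mulSn; apply: leading_formM.
Qed.

Lemma leading_form_prod (I : finType) (p w : I -> {mpoly F[n]}) (d : I -> nat) :
  (forall i, leading_form (p i) (w i) (d i)) ->
  leading_form (\prod_i p i) (\prod_i w i) (\sum_i d i).
Proof.
move=> lp; elim: (index_enum I) => [|i s IH].
  by rewrite !big_nil; apply: leading_form1.
by rewrite !big_cons; apply: leading_formM.
Qed.

(** Multiplication by a form of degree [e] shifts the grading by [e]; by linearity this is checked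
    on monomials of [p]. *)
Lemma pihomogMr p w d e : w \is e.-homog ->
  pihomog mdeg d (p * w) = if (e <= d)%N then pihomog mdeg (d - e) p * w else 0.
Proof.
move=> hw; have term c m : pihomog mdeg d (c *: 'X_[m] * w) =
    if (e <= d)%N then pihomog mdeg (d - e) (c *: 'X_[m]) * w else 0.
  rewrite -scalerAl [LHS]linearZ [pihomog _ _ (_ *: _)]linearZ /= pihomogX.
  have hmw : 'X_[m] * w \is (mdeg m + e).-homog.
    by apply: dhomogM => //; rewrite dhomogX.
  have [ed|de] := leqP e d.
    have [me|me] := eqVneq (mdeg m) (d - e)%N.
      by rewrite pihomog_dE ?scalerAl // -(subnK ed) -me.
    rewrite scaler0 mul0r (pihomog_ne0 _ hmw) ?scaler0 //.
    by rewrite -(subnK ed) eqn_add2r.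
  rewrite (pihomog_ne0 _ hmw) ?scaler0 //.
  by rewrite neq_ltn (leq_trans de) ?orbT // leq_addl.
rewrite (mpolyE p) mulr_suml !raddf_sum /=.
under eq_bigr do rewrite term.
by case: leqP => _; rewrite ?mulr_suml // big1.
Qed.

(** Take the component of degree [N = deg u] of the given relation. On the left only ['X_j ^+ N]
    survives; on the right each [h i] is replaced by its component of degree [N - e i], or by zero
    if [e i > N]. *)
Lemma homog_ideal_power (I : finType) (w : I -> {mpoly F[n]}) (e : I -> nat) j
    (u : {poly F}) :
  (forall i, w i \is (e i).-homog) -> u \is monic ->
  generated_ideal w (horner_alg 'X_j u) ->
  exists h : I -> {mpoly F[n]}, 'X_j ^+ (size u).-1 = \sum_i h i * w i /\
    forall i, h i = 0 \/ (msize (h i) + e i <= size u)%N.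
Proof.
move=> hw mon_u [h uh]; set N := (size u).-1.
have sN : N.+1 = size u by rewrite /N prednK // lt0n size_poly_eq0 monic_neq0.
exists (fun i => if (e i <= N)%N then pihomog mdeg (N - e i) (h i) else 0).
split=> [|i]; last first.
  case: leqP => ei; [right | by left].
  rewrite -sN -[X in (_ <= X.+1)%N](subnK ei) -addSn leq_add2r.
  by apply: dhomog_msize_leq; apply: pihomogP.
have := congr1 (pihomog mdeg N) uh; rewrite !raddf_sum /=.
(* The zero branch is written [0 * w i] so that [w i] factors out of the conditional. *)
under [X in _ = X -> _]eq_bigr => i _ do
  rewrite (pihomogMr _ _ (hw i)) -[X in if _ then _ else X](mul0r (w i))
          -(fun_if (fun z => z * w i)).
move=> <-; rewrite -[X in horner_alg _ X]coefK poly_def rmorph_sum raddf_sum /=.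
have Xk k : 'X_j ^+ k \is [in F[n], k.-homog].
  by rewrite mpolyXn dhomogX /= mdegMn mdeg1 mul1n.
rewrite -sN big_ord_recr big1 /= => [|k _].
  rewrite add0r linearZ /= mulr_algl rmorphXn /= horner_algX linearZ /=.
  by rewrite pihomog_dE // -lead_coefE (monicP mon_u) scale1r.
rewrite linearZ /= mulr_algl rmorphXn /= horner_algX linearZ /=.
by rewrite (pihomog_ne0 _ (Xk k)) ?scaler0 // neq_ltn ltn_ord.
Qed.

(* The terms of maximal weight of a relation between the [f]'s, where the
   [i]-th variable has weight [d i], form a relation between the [w]'s. *)
Lemma leading_form_independent r (f w : r.-tuple {mpoly F[n]}) (d : 'I_r -> nat) :
  (forall i, leading_form (tnth f i) (tnth w i) (d i)) ->
  algebraically_independent w -> algebraically_independent f.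
Proof.
move=> lf indep q qf; apply/eqP; apply: contrapT => /negP q0.
pose wt (m : 'X_{1..r}) := (\sum_i m i * d i)%N.
have wtP (m : 'X_{1..r}) :
    leading_form ('X_[m] \mPo f) ('X_[m] \mPo w) (wt m).
  by rewrite !comp_mpolyX; apply: leading_form_prod => i; apply: leading_formX.
pose P k := has (fun m => wt m == k) (msupp q).
have exP : exists k, P k.
  exists (wt (mlead q)); apply/hasP; exists (mlead q) => //.
  exact: mlead_supp.
have bndP k : P k -> (k <= \max_(m <- msupp q) wt m)%N.
  by case/hasP => m mq /eqP <-; apply: leq_bigmax_seq.
case: (ex_maxnP exP bndP) => D /hasP[m0 m0q /eqP m0D] maxD.
have wtD m : m \in msupp q -> (wt m <= D)%N.
  by move=> mq; apply: maxD; apply/hasP; exists m.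
pose q' := \sum_(m <- msupp q | wt m == D) q@_m *: 'X_[m].
have q'w_homog : q' \mPo w \is D.-homog.
  rewrite raddf_sum rpred_sum // => m /eqP mD /=.
  by rewrite comp_mpolyZ rpredZ // -mD; case: (wtP m).
(* This form of degree [D] also has degree less than [D]: up to sign it is the difference with
   [q \mPo f = 0], where the terms of weight [D] cancel to leading order and the others have smaller
   weight. *)
have q'w : q' \mPo w = 0.
  apply: (dhomog_small q'w_homog); rewrite -(msizeN (q' \mPo w)).
  have -> : - (q' \mPo w) = (q \mPo f) - (q' \mPo w) by rewrite qf sub0r.
  rewrite {1}[q]mpolyE !(raddf_sum (comp_mpoly _)) /=.
  rewrite [X in _ - X]big_mkcond -sumrB big_seq.
  apply: msize_sum_leq => m mq; case: eqP => [mD|/eqP mD].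
    rewrite !comp_mpolyZ -scalerBr (leq_trans (msizeZ_le _ _)) // -mD.
    by case: (wtP m).
  rewrite subr0 comp_mpolyZ (leq_trans (msizeZ_le _ _)) //.
  rewrite (leq_trans (leading_form_msize (wtP m))) //.
  by rewrite ltn_neqAle mD wtD.
have := congr1 (mcoeff m0) (indep _ q'w).
rewrite mcoeff0 raddf_sum -big_filter (bigD1_seq m0) /=; last 2 first.
- by rewrite mem_filter m0D eqxx.
- by rewrite filter_uniq // msupp_uniq.
rewrite mcoeffZ mcoeffX eqxx mulr1 big1 ?addr0 => [|m /negPf mm0].
  by move/eqP; rewrite mcoeff_eq0 m0q.
by rewrite mcoeffZ mcoeffX mm0 mulr0.
Qed.

(** Some power of each ['X_j] is a combination of the [w i], so in a monomial with a large exponent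
    it can be rewritten through [w i = f i - (f i - w i)]. Both resulting kinds of terms involve
    polynomials of smaller degree, and the monomials with bounded exponents span. *)
Lemma leading_form_spans_over r (f w : r.-tuple {mpoly F[n]}) (d : 'I_r -> nat) :
  (forall i, leading_form (tnth f i) (tnth w i) (d i)) ->
  (forall i, 0 < d i)%N ->
  (forall j, exists2 u : {poly F},
     u \is monic & generated_ideal (tnth w) (horner_alg 'X_j u)) ->
  exists (I : finType) (m : I -> {mpoly F[n]}), spans_over f m.
Proof.
move=> lf d0 alg.
have /choice[N0 NP] : forall j : 'I_n, exists N, exists h : 'I_r -> {mpoly F[n]},
    'X_j ^+ N = \sum_i h i * tnth w i /\
    forall i, h i = 0 \/ (msize (h i) + d i <= N.+1)%N.
  move=> j; have [u mon_u Ju] := alg j; exists (size u).-1.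
  have [|h [hX hd]] := homog_ideal_power _ mon_u Ju (e := d).
    by move=> i; case: (lf i).
  by exists h; rewrite prednK // lt0n size_poly_eq0 monic_neq0.
have {NP} /choice[h hP] := NP.
(* A monomial with an exponent at least [N] in ['X_j] is divisible by ['X_j ^+ N0 j]. *)
pose N := (\max_j N0 j).+1.
pose I := {ffun 'I_n -> 'I_N}.
pose mon (a : I) : {mpoly F[n]} := 'X_[ [multinom (a i : nat) | i < n] ].
exists I, mon; pose S p := exists q : I -> {mpoly F[r]},
  p = \sum_i (q i \mPo f) * mon i.
have S0 : S 0.
  by exists (fun=> 0); rewrite big1 // => i _; rewrite comp_mpoly0 mul0r.
have SD p p' : S p -> S p' -> S (p + p').
  move=> [q ->] [q' ->]; exists (fun i => q i + q' i).
  by rewrite -big_split; apply: eq_bigr => i _; rewrite comp_mpolyD mulrDl.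
have SM (c : {mpoly F[r]}) p : S p -> S ((c \mPo f) * p).
  move=> [q ->]; exists (fun i => c * q i).
  by rewrite mulr_sumr; apply: eq_bigr => i _; rewrite rmorphM mulrA.
have Smon a : S (mon a).
  exists (fun b => (b == a)%:R).
  rewrite (bigD1 a) //= eqxx rmorph1 mul1r big1 ?addr0 // => b /negPf ->.
  by rewrite rmorph0 mul0r.
suff S_small k p : (msize p <= k)%N -> S p by move=> p; exact: S_small (leqnn _).
elim: k p => [|k IH] p.
  by rewrite leqn0 msize_poly_eq0 => /eqP ->.
move=> pk; rewrite (mpolyE p) big_seq; apply: (big_ind S) => // m mp.
have mk : (mdeg m <= k)%N.
  by rewrite -ltnS (leq_trans (msize_mdeg_lt mp)).
rewrite -mul_mpolyC -(comp_mpolyC _ f); apply: (SM); clear p pk mp.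
have [/forallP mN|] := boolP [forall j, m j < N]%N.
  have -> : 'X_[m] = mon [ffun j => Ordinal (mN j)] by
    congr mpolyX; apply/mnmP => j; rewrite mnmE ffunE.
  exact: Smon.
rewrite negb_forall => /existsP[j]; rewrite -leqNgt => Nm.
have {Nm} Nm : (N0 j <= m j)%N.
  by rewrite (leq_trans _ (ltnW Nm)) // leq_bigmax.
pose m' := (m - U_(j) *+ N0 j)%MM.
have mE : m = (m' + U_(j) *+ N0 j)%MM.
  rewrite submK //; apply/mnm_lepP => i; rewrite mulmnE mnm1E.
  by case: eqP => [<-|_]; rewrite ?mul1n ?mul0n.
have degm : (mdeg m' + N0 j <= k)%N.
  by move: mk; rewrite {1}mE mdegD mdegMn mdeg1 mul1n.
have [hX hd] := hP j.
have -> : 'X_[m] = \sum_i ('X_i \mPo f) * ('X_[m'] * h j i)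
    - \sum_i 'X_[m'] * h j i * (tnth f i - tnth w i).
  rewrite {1}mE mpolyXD -mpolyXn hX -sumrB mulr_sumr; apply: eq_bigr => i _.
  rewrite comp_mpolyXU -tnth_nth mulrBr [tnth f i * _]mulrC opprB addrC subrK.
  by rewrite mulrA.
rewrite -sumrB; apply: (big_ind S) => // i _.
have [->|hi] := hd i.
  by rewrite !mulr0 mul0r subr0.
apply: (SD).
  (* The cofactor of [f i] drops in degree because [d i] is positive. *)
  apply: (SM); apply: IH; rewrite (leq_trans _ degm) // msizeM_leq ?msizeX //.
  by move: hi (d0 i); case: (d i) => // di; rewrite addnS ltnS => hi _;
     rewrite (leq_trans _ hi) // leq_addr.
(* Here the degree drops because [f i - w i] has degree less than [d i]. *)
rewrite -mulrN opprB; apply: IH.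
have [->|h0] := eqVneq (h j i) 0; first by rewrite mulr0 mul0r msize0.
have hl : (msize (h j i)).-1.+1 = msize (h j i).
  by rewrite prednK // lt0n msize_poly_eq0.
rewrite (leq_trans _ degm) // -mulrA msizeM_leq ?msizeX //.
rewrite (leq_trans (msizeM_leq (b := d i) (a := (msize (h j i)).-1) _ _)) ?hl //.
  by rewrite -msizeN opprB; case: (lf i).
by rewrite -ltnS -addSn hl.
Qed.

End LeadingForms.

(** Finiteness and independence pass from the leading forms [w] to [f], after which [ideal_zero]
    applies to the ideal of [f]. *)
Theorem leading_forms_common_zero (F : closedFieldType) n
    (f w : n.-tuple {mpoly F[n]}) (d : 'I_n -> nat) :
  (forall i, leading_form (tnth f i) (tnth w i) (d i)) ->
  (forall i, 0 < d i)%N ->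
  algebraically_independent w ->
  (forall j, exists2 u : {poly F},
     u \is monic & generated_ideal (tnth w) (horner_alg 'X_j u)) ->
  exists a : 'I_n -> F, forall i, (tnth f i).@[a] = 0.
Proof.
move=> lf d0 indep alg.
have [I [m span_m]] := leading_form_spans_over lf d0 alg.
have [|j|a a0] := @ideal_zero F n _ (generated_ideal_is_ideal (tnth f)).
- exact: spans_over_proper (leading_form_independent lf indep) span_m.
- exact: spans_over_algebraic span_m _.
- by exists a => i; apply/a0/generated_ideal_gen.
Qed.

(** * Invariants of a polynomial group *)

Section AlgebraicDependence.
Variables (F : fieldType) (n : nat).
Implicit Types p q : {mpoly F[n]}.

(** Bounding each exponent separately, rather than the total degree, makes the number of admissible
    monomials a plain power. *)
Definition exponents_le (b : nat) p : Prop :=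
  forall m, m \in msupp p -> forall j, (m j <= b)%N.

Lemma exponents_le_msize p : exponents_le (msize p) p.
Proof.
move=> m /msize_mdeg_lt /ltnW mp j; apply: leq_trans mp.
by rewrite mdegE (bigD1 j) //= leq_addr.
Qed.

Lemma exponents_leM a b p q :
  exponents_le a p -> exponents_le b q -> exponents_le (a + b) (p * q).
Proof.
move=> pa qb m /msuppM_le /allpairsP[[m1 m2] /= [m1p m2q ->]] j.
by rewrite mnmDE leq_add ?pa ?qb.
Qed.

Lemma exponents_le1 : exponents_le 0 1.
Proof. by move=> m; rewrite msupp1 inE => /eqP -> j; rewrite mnm0E. Qed.

Lemma exponents_leX b p k : exponents_le b p -> exponents_le (k * b) (p ^+ k).
Proof.
move=> pb; elim: k => [|k IH]; first by rewrite mul0n; apply: exponents_le1.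
by rewrite exprS mulSn; apply: exponents_leM.
Qed.

Lemma exponents_le_prod (I : finType) (p : I -> {mpoly F[n]}) (b : I -> nat) :
  (forall i, exponents_le (b i) (p i)) ->
  exponents_le (\sum_i b i) (\prod_i p i).
Proof.
move=> pb; elim: (index_enum I) => [|i s IH].
  by rewrite !big_nil; apply: exponents_le1.
by rewrite !big_cons; apply: exponents_leM.
Qed.

(* Among the [t^a x^k], [a_i, k < d], there are [d ^ n.+1] products; their
   exponents are [< d * c] with [c] independent of [d], so that they live in a
   space of dimension [(d * c) ^ n], which is smaller for large [d]. *)
Lemma algebraic_over_independent (t : n.-tuple {mpoly F[n]}) (x : {mpoly F[n]}) :
  algebraically_independent t ->
  exists2 Q : {poly {mpoly F[n]}},
    map_poly (comp_mpoly t) Q != 0 & root (map_poly (comp_mpoly t) Q) x.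
Proof.
move=> indep; pose c := (\sum_i msize (tnth t i) + msize x).+1.
(* The count [(d * c) ^ n < d ^ n.+1] amounts to [c ^ n < d]. *)
pose d := (c ^ n).+1.
pose row : finType := ('I_d * {ffun 'I_n -> 'I_d})%type.
pose col : finType := {ffun 'I_n -> 'I_(d * c)}.
pose mon k (a : {ffun 'I_n -> 'I_k}) := [multinom (a i : nat) | i < n].
have mon_inj k : injective (@mon k).
  move=> a b /mnmP ab; apply/ffunP => i; apply/val_inj.
  by have := ab i; rewrite !mnmE.
pose T (ka : row) := ('X_[mon d ka.2] \mPo t) * x ^+ ka.1.
have Tle ka : exponents_le (d * c).-1 (T ka).
  have -> : (d * c).-1 = (d * c.-1 + d.-1)%N by rewrite mulnS /= addnC.
  move=> m mT j; apply: leq_trans (leq_addr _ _).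
  move: m mT j; rewrite -/(exponents_le _ _) {1}/c /= mulnDr big_distrr /=.
  have H : exponents_le (\sum_i mon d ka.2 i * msize (tnth t i) +
      ka.1 * msize x) (T ka).
    apply: exponents_leM; last exact/exponents_leX/exponents_le_msize.
    rewrite comp_mpolyX; apply: exponents_le_prod => i.
    exact/exponents_leX/exponents_le_msize.
  move=> m mT j; apply: leq_trans (H m mT j) _.
  apply: leq_add; last by rewrite leq_mul2r ltnW ?orbT.
  by apply: leq_sum => i _; rewrite mnmE leq_mul2r ltnW ?orbT.
have cards : (#|col| < #|row|)%N.
  rewrite card_prod !card_ffun !card_ord expnMn mulnC.
  by rewrite ltn_pmul2r ?ltnSn // expn_gt0.
(* A linear relation between the products [T], read on the coefficients of the monomials in the
   box. *)
have [v v0 vM] := kernel_neq0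
  (\matrix_(a, b) (T (enum_val a))@_(mon _ (enum_val b))) cards.
pose vv ka := v ord0 (enum_rank ka).
pose a k := \sum_b vv (k, b) *: 'X_[mon d b] : {mpoly F[n]}.
pose Q := \poly_(k < d) a (inord k).
have aQ (k : 'I_d) : Q`_k = a k by rewrite coef_poly ltn_ord inord_val.
have [k0 ak0] : exists k, a k != 0.
  have [i vi] : exists i, v ord0 i != 0.
    apply/existsP; apply: contraR v0 => /existsPn v0.
    by apply/eqP/rowP => i; rewrite mxE; apply/eqP; rewrite -[_ == _]negbK.
  exists (enum_val i).1; apply: contra vi => /eqP ai0.
  have := congr1 (mcoeff (mon d (enum_val i).2)) ai0.
  rewrite mcoeff0 raddf_sum (bigD1 (enum_val i).2) //= big1 => [|b bi].
    rewrite mcoeffZ mcoeffX eqxx mulr1 addr0 /vv -surjective_pairing.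
    by rewrite enum_valK => ->.
  by rewrite mcoeffZ mcoeffX (inj_eq (@mon_inj d)) (negPf bi) mulr0.
exists Q.
  (* Independence of [t] keeps the nonzero coefficient [a k0] nonzero after substitution. *)
  apply: contra ak0 => /eqP Q0; apply/eqP/indep.
  by rewrite -aQ -coef_map Q0 coef0.
rewrite /root; apply/eqP.
have -> : (map_poly (comp_mpoly t) Q).[x] = \sum_ka vv ka *: T ka.
  rewrite (@horner_coef_wide _ d) => [|]; last first.
    by rewrite (leq_trans (size_poly _ _)) // size_poly.
  transitivity (\sum_k \sum_b vv (k, b) *: T (k, b)); last first.
    by rewrite pair_bigA; apply: eq_bigr => -[].
  apply: eq_bigr => k _; rewrite coef_map aQ raddf_sum mulr_suml.
  by apply: eq_bigr => b _ /=; rewrite comp_mpolyZ scalerAl.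
apply/mpolyP => m; rewrite mcoeff0 raddf_sum /=.
(* Outside the box the coefficients vanish by [Tle]; inside it they are governed by [vM]. *)
have [/forallP mb|] := boolP [forall j, m j < d * c]%N; last first.
  rewrite negb_forall => /existsP[j mj]; apply: big1 => ka _.
  rewrite mcoeffZ memN_msupp_eq0 ?mulr0 //; apply: contra mj => /Tle /(_ j).
  by rewrite -ltnS prednK // muln_gt0.
have -> : m = mon _ [ffun j => Ordinal (mb j)].
  by apply/mnmP => j; rewrite mnmE ffunE.
move: [ffun j => _] => b; move/matrixP/(_ ord0 (enum_rank b)): vM.
rewrite !mxE => vb; rewrite -[RHS]vb (reindex (@enum_val row row)) /=; last first.
  by exists enum_rank => k _; rewrite ?enum_valK ?enum_rankK.
by apply: eq_bigr => i _; rewrite mcoeffZ mxE enum_rankK /vv enum_valK.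
Qed.

End AlgebraicDependence.

(** Uniqueness of expansions in base [D]: reduction modulo [D] gives the lowest digit, and division
    by [D] leaves the others to the induction. *)
Lemma digits_inj (D n : nat) (a b : 'I_n -> nat) :
  (forall i, a i < D)%N -> (forall i, b i < D)%N ->
  (\sum_i a i * D ^ i = \sum_i b i * D ^ i)%N -> a =1 b.
Proof.
elim: n a b => [|n IH] a b aD bD; first by move=> _ [].
have split_sum (u : 'I_n.+1 -> nat) :
    (\sum_i u i * D ^ i = (\sum_i u (lift ord0 i) * D ^ i) * D + u ord0)%N.
  rewrite big_ord_recl muln1 addnC big_distrl /=; congr addn.
  by apply: eq_bigr => i _; rewrite /bump add1n expnSr mulnA.
rewrite !split_sum => e.
have e0 : a ord0 = b ord0.
  by have := congr1 (modn^~ D) e; rewrite !modnMDl !modn_small.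
move: e; rewrite e0 => /addIn /eqP; rewrite eqn_pmul2r; last first.
  by rewrite (leq_trans _ (bD ord0)).
move/eqP/IH => IHe i.
by have [j ->|->//] := unliftP ord0 i; apply: IHe => k.
Qed.

(** * Nonvanishing of polynomials over a field of characteristic zero *)

Section InfiniteField.
Variables (F : numFieldType) (n : nat).

(** The integers below [size q] are distinct in [F] and more numerous than the roots of [q]. *)
Lemma poly_nonroot (q : {poly F}) : q != 0 -> exists x, q.[x] != 0.
Proof.
move=> q0; have : ~~ all (root q) [seq i%:R | i <- iota 0 (size q)].
  apply: contraL (leqnn (size q)) => roots; rewrite -ltnNge.
  rewrite -{1}(size_iota 0 (size q)) -(size_map (fun i => i%:R : F)).
  apply: max_poly_roots => //; rewrite map_inj_uniq ?iota_uniq //.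
  exact: mulrIn (oner_neq0 _).
by move/allPn => [x _ qx]; exists x.
Qed.

(* Kronecker's substitution ['X_i := x ^+ (D ^ i)]. *)
Lemma mpoly_nonroot (p : {mpoly F[n]}) : p != 0 -> exists v, p.@[v] != 0.
Proof.
move=> p0; pose D := (msize p).+1.
pose wt (m : 'X_{1..n}) := (\sum_(i < n) m i * D ^ i)%N.
have mD m : m \in msupp p -> forall i, (m i < D)%N.
  by move=> mp i; rewrite ltnS; apply: (exponents_le_msize mp).
(* By [digits_inj] distinct monomials of [p] have distinct weights, so no cancellation occurs in
   [q]. *)
pose q : {poly F} := \sum_(m <- msupp p) p@_m *: 'X^(wt m).
have q0 : q != 0.
  have lp := mlead_supp p0; apply: contra p0 => /eqP q0.
  rewrite -mleadc_eq0 -(coef0 _ (wt (mlead p))) -q0 coef_sum.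
  rewrite (bigD1_seq (mlead p)) ?msupp_uniq //= coefZ coefXn eqxx mulr1.
  rewrite big_seq_cond big1 ?addr0 // => m /andP[mp mlp].
  rewrite coefZ coefXn; case: eqP => [/digits_inj e|]; last by rewrite mulr0.
  by case/negP: mlp; apply/eqP/mnmP => i; rewrite e //; apply: mD.
have [x qx] := poly_nonroot q0; exists (fun i => x ^+ (D ^ i)).
suff -> : p.@[fun i => x ^+ (D ^ i)] = q.[x] by [].
rewrite mevalE horner_sum; apply: eq_bigr => m _.
rewrite hornerZ hornerXn; congr (_ * _).
by rewrite -prodrXr; apply: eq_bigr => i _; rewrite -exprM mulnC.
Qed.

End InfiniteField.

(** Duplicate-free lists in [S] are bounded in length by the number of roots; one of maximal length
    exhausts [S]. *)
Lemma finite_set_of_roots (A : idomainType) (Q : {poly A}) (S : A -> Prop) :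
  Q != 0 -> (forall x, S x -> root Q x) ->
  exists2 s : seq A, uniq s & forall x, x \in s <-> S x.
Proof.
move=> Q0 SQ.
pose P k := `[< exists s : seq A, [/\ size s = k, uniq s & {in s, forall x, S x}] >].
have exP : exists k, P k by exists 0%N; apply/asboolP; exists [::].
have bndP k : P k -> (k <= size Q)%N.
  move=> /asboolP[s [<- us sS]]; apply/ltnW/max_poly_roots => //.
  by apply/allP => x /sS /SQ.
case: (ex_maxnP exP bndP) => k /asboolP[s [sk us sS]] kmax.
exists s => // x; split => [/sS //|Sx].
apply: contraT => xs; have /kmax : P k.+1.
  apply/asboolP; exists (x :: s); rewrite /= sk xs; split => // y.
  by rewrite in_cons => /orP[/eqP ->|/sS].
by rewrite ltnn.
Qed.

Section Invariants.
Variables (F : numFieldType) (n : nat).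
Notation V := 'rV[F]_n.

Definition row_eval (P : {mpoly F[n]}) (l : V) : F := P.@[fun i => l ord0 i].

Lemma row_evalM P Q l : row_eval (P * Q) l = row_eval P l * row_eval Q l.
Proof. exact: mevalM. Qed.

Lemma row_eval_inj P Q : row_eval P =1 row_eval Q -> P = Q.
Proof.
move=> PQ; apply/eqP; rewrite -subr_eq0; apply: contraT.
move=> /mpoly_nonroot[v]; rewrite mevalB.
have := PQ (\row_i v i); rewrite /row_eval.
under meval_eq do rewrite mxE.
by under [in RHS]meval_eq do rewrite mxE; move=> ->; rewrite subrr eqxx.
Qed.

(** Surjectivity stands in for inverses: it makes the pullback of polynomials injective, and an
    injective map of a finite orbit into itself permutes it. *)
Record polynomial_group (T : (V -> V) -> Prop) : Prop := PolynomialGroup {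
  pg_id : exists2 w, T w & w =1 id;
  pg_comp : forall w w', T w -> T w' -> T (w \o w');
  pg_surj : forall w, T w -> forall l, exists l', w l' = l;
  pg_poly : forall w, T w -> forall j, exists p, forall l,
    w l ord0 j = row_eval p l
}.

Variables (T : (V -> V) -> Prop) (gT : polynomial_group T).

Definition invariant_under (P : {mpoly F[n]}) : Prop :=
  forall w l, T w -> row_eval P (w l) = row_eval P l.

Lemma invariantM P Q :
  invariant_under P -> invariant_under Q -> invariant_under (P * Q).
Proof. by move=> iP iQ w l Tw; rewrite !row_evalM iP ?iQ. Qed.

Lemma invariant_comp r (t : r.-tuple {mpoly F[n]}) (q : {mpoly F[r]}) :
  (forall i, invariant_under (tnth t i)) -> invariant_under (q \mPo t).
Proof.
move=> it w l Tw; rewrite /row_eval !comp_mpoly_meval.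
by apply: meval_eq => i; apply: it.
Qed.

Lemma row_eval_horner (Q : {poly {mpoly F[n]}}) p l :
  row_eval Q.[p] l = (map_poly (row_eval^~ l) Q).[row_eval p l].
Proof. by rewrite /row_eval (horner_map (meval _)). Qed.

Variable t : n.-tuple {mpoly F[n]}.
Hypothesis t_independent : algebraically_independent t.
Hypothesis t_invariant : forall i, invariant_under (tnth t i).

(** The transforms of a coordinate are taken as polynomials, to be compared with roots in [{mpoly
    F[n]}]. *)
Definition in_orbit (j : 'I_n) (p : {mpoly F[n]}) : Prop :=
  exists2 w, T w & forall l, row_eval p l = w l ord0 j.

(* The coordinate ['X_j] is a root of a nonzero polynomial [Q] with invariant
   coefficients, hence so are its transforms. *)
Lemma orbit_finite (j : 'I_n) : exists2 s : seq {mpoly F[n]},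
  uniq s & forall p, p \in s <-> in_orbit j p.
Proof.
have [Q0 Q_neq0 Qx] := algebraic_over_independent 'X_j t_independent.
apply: (finite_set_of_roots Q_neq0) => p [w Tw pw].
apply/eqP/row_eval_inj => l; rewrite row_eval_horner pw.
have -> : w l ord0 j = row_eval 'X_j (w l) by rewrite /row_eval mevalXU.
(* The coefficients are polynomials in [t], hence take the same value at [l] and at [w l]. *)
have -> : map_poly (row_eval^~ l) (map_poly (comp_mpoly t) Q0) =
    map_poly (row_eval^~ (w l)) (map_poly (comp_mpoly t) Q0).
  apply/polyP => i; rewrite !(coef_map (meval _)) coef_map /=.
  by rewrite -/(row_eval _ _) -/(row_eval _ (w l)) (invariant_comp _ t_invariant).
by rewrite -row_eval_horner (eqP Qx) /row_eval !meval0.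
Qed.

(** [G] is the product of the ['X - p] over the orbit; its coefficients are symmetric in the orbit,
    which every transformation permutes. *)
Lemma orbit_polynomial (j : 'I_n) : exists G : {poly {mpoly F[n]}},
  [/\ G \is monic, (1 < size G)%N, root G 'X_j & forall i, invariant_under G`_i].
Proof.
have [s us sP] := orbit_finite j.
pose G := \prod_(p <- s) ('X - p%:P).
have Xs : 'X_j \in s.
  have [w Tw w1] := pg_id gT; apply/sP; exists w => // l.
  by rewrite w1 /row_eval mevalXU.
exists G; split.
- exact: monic_prod_XsubC.
- by rewrite size_prod_XsubC ltnS; case: (s) Xs.
- by rewrite root_prod_XsubC.
move=> i w l Tw; have /choice[c cE] := pg_poly gT Tw.
(* Pullback by [w], realized as a substitution. *)
pose phi (p : {mpoly F[n]}) := p \mPo [tuple c k | k < n].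
have phiE p l' : row_eval (phi p) l' = row_eval p (w l').
  rewrite /row_eval comp_mpoly_meval; apply: meval_eq => k.
  by rewrite tnth_mktuple cE.
have phi_inj : injective phi.
  move=> p q pq; apply: row_eval_inj => l'.
  by have [l0 <-] := pg_surj gT Tw l'; rewrite -!phiE pq.
have s_phi : perm_eq (map phi s) s.
  apply: uniq_perm => //; first by rewrite map_inj_uniq.
  have [] // := @uniq_min_size _ (map phi s) s.
  - by rewrite map_inj_uniq.
  - move=> _ /mapP[p /sP[w' Tw' pw'] ->]; apply/sP; exists (w' \o w).
      exact: pg_comp.
    by move=> l'; rewrite phiE pw'.
  - by rewrite size_map.
have Gi l' : row_eval G`_i l' = (\prod_(p <- s) ('X - (row_eval p l')%:P))`_i.
  rewrite /row_eval -(coef_map (meval _)) rmorph_prod.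
  by congr ((polyseq _)`_i); apply: eq_bigr => p _; rewrite rmorphB /= map_polyX map_polyC.
rewrite !Gi -[in RHS](perm_big _ s_phi) big_map.
by congr ((polyseq _)`_i); apply: eq_bigr => p _; rewrite phiE.
Qed.

(** Modulo the ideal of [t], invariants reduce to combinations of the [e i] over [F], and the orbit
    polynomial reduces powers of ['X_j] below [N]. The finitely many [e i * 'X_j ^+ k] therefore
    span all powers. *)
Lemma variable_algebraic (I : finType) (e : I -> {mpoly F[n]}) :
  (forall P, invariant_under P <-> exists q : I -> {mpoly F[n]},
     P = \sum_i (q i \mPo t) * e i) ->
  forall j, exists2 u : {poly F},
    u \is monic & generated_ideal (tnth t) (horner_alg 'X_j u).
Proof.
move=> inv_e j; have [G [mon_G sG Gj invG]] := orbit_polynomial j.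
pose N := (size G).-1; pose x : {mpoly F[n]} := 'X_j.
have N0 : (0 < N)%N by rewrite /N -ltnS prednK // ltnW.
pose J := generated_ideal (tnth t).
have idJ : is_ideal J by apply: generated_ideal_is_ideal.
pose m (ik : I * 'I_N) := e ik.1 * x ^+ ik.2.
apply: (ideal_algebraic idJ (m := m)).
(* The span of the [m a] over [F], modulo [J]. *)
pose S y := exists c : I * 'I_N -> F, J (y - \sum_a c a *: m a).
have SJ y : J y -> S y.
  by exists (fun=> 0); rewrite big1 ?subr0 // => a _; rewrite scale0r.
have S0 : S 0 by apply: (SJ); apply: ideal0.
have SD y z : S y -> S z -> S (y + z).
  move=> [c Jc] [d Jd]; exists (fun a => c a + d a).
  under eq_bigr do rewrite scalerDl.
  by rewrite big_split opprD addrACA; apply: idealD.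
have SZ b y : S y -> S (b *: y).
  move=> [c Jc]; exists (fun a => b * c a).
  under eq_bigr do rewrite -scalerA.
  by rewrite -scaler_sumr -scalerBr; apply: idealZ.
have Sm a : S (m a).
  exists (fun b => (b == a)%:R); rewrite (bigD1 a) //= eqxx scale1r big1.
    by rewrite addr0 subrr; apply: ideal0.
  by move=> b /negPf ->; rewrite scale0r.
have Sinv P (k : 'I_N) : invariant_under P -> S (P * x ^+ k).
  move=> /inv_e[q ->]; rewrite mulr_suml; apply: (big_ind S) => // i _.
  have -> : (q i \mPo t) * e i * x ^+ k =
      m (i, k) * ((q i \mPo t) - ((q i)@_0%MM)%:MP) + (q i)@_0%MM *: m (i, k).
    rewrite mulrBr -mul_mpolyC [m (i, k) * _%:MP]mulrC subrK /m /=.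
    by rewrite [RHS]mulrC mulrA.
  apply: (SD); last exact/SZ/Sm.
  apply: (SJ); apply: idealMl => //; apply: comp_mpoly_mod_ideal => // a.
  exact: generated_ideal_gen.
have inv_gen i : invariant_under (e i).
  apply/inv_e; exists (fun k => (k == i)%:R).
  rewrite (bigD1 i) //= eqxx rmorph1 mul1r big1 ?addr0 // => k /negPf ->.
  by rewrite rmorph0 mul0r.
have xN : x ^+ N = - \sum_(k < N) G`_k * x ^+ k.
  apply/eqP; rewrite -subr_eq0 opprK addrC; move: Gj.
  rewrite /root horner_coef -(prednK (ltnW sG)) big_ord_recr /=.
  by rewrite -/N -[G`_N]/(lead_coef G) (monicP mon_G) mul1r.
(* Only the exponent [N] overflows; [xN] then brings in the products [e i * G_k], which are
   invariant and covered by [Sinv]. *)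
have Sx y : S y -> S (y * x).
  move=> [c Jc]; rewrite -[y](subrK (\sum_a c a *: m a)) mulrDl.
  apply: (SD); first by apply: (SJ); rewrite mulrC; apply: idealMl.
  rewrite mulr_suml; apply: (big_ind S) => // -[i k] _.
  rewrite -scalerAl; apply: (SZ); rewrite /m /= -mulrA -exprSr.
  have [kN|] := ltnP k.+1 N; first exact: (Sm (i, Ordinal kN)).
  move=> Nk; have -> : k.+1 = N by apply/eqP; rewrite eqn_leq Nk ltn_ord.
  rewrite xN mulrN -scaleN1r; apply: (SZ); rewrite mulr_sumr.
  apply: (big_ind S) => // k' _.
  by rewrite mulrA; apply: (Sinv); apply: invariantM.
elim=> [|k IH]; last by rewrite exprSr; apply: (Sx).
have -> : x ^+ 0 = 1 * x ^+ Ordinal N0 by rewrite mul1r.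
by apply: (Sinv) => w l Tw; rewrite /row_eval !meval1.
Qed.

End Invariants.

(** * Lie-theoretic data *)

Section Translation.
Variables (F : fieldType) (n k : nat).

(** Each affine factor [L i + c i] has leading form [L i], and leading forms multiply along the
    monomials of [U]. *)
Lemma leading_form_translate (U : {mpoly F[k]}) (e : nat)
    (L : 'I_k -> {mpoly F[n]}) (c : 'I_k -> F) :
  U \is e.-homog -> (forall i, L i \is 1.-homog) ->
  leading_form (U \mPo [tuple L i + (c i)%:MP | i < k])
    (U \mPo [tuple L i | i < k]) e.
Proof.
move=> /dhomogP hU hL; split.
  rewrite comp_mpolyE big_seq; apply: rpred_sum => m mU; apply: rpredZ.
  have -> : e = (\sum_i m i)%N by rewrite -mdegE -[LHS](hU m mU).
  elim: (index_enum _) => [|i s IH].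
    by rewrite !big_nil; apply: dhomog1.
  rewrite !big_cons; apply: dhomogM IH; rewrite tnth_mktuple.
  by rewrite -[m i in X in X.-homog]mul1n; apply: dhomogMn.
rewrite !comp_mpolyE -sumrB big_seq; apply: msize_sum_leq => m mU.
rewrite -scalerBr (leq_trans (msizeZ_le _ _)) //.
have -> : e = (\sum_i m i * 1)%N.
  by under eq_bigr do rewrite muln1; rewrite -mdegE -[LHS](hU m mU).
apply: (leading_form_prod _).2 => i; apply: leading_formX.
rewrite !tnth_mktuple; split => //.
by rewrite addrC addKr msizeC leq_b1.
Qed.

Lemma leading_form_subC (p w : {mpoly F[n]}) d c :
  (0 < d)%N -> leading_form p w d -> leading_form (p - c%:MP) w d.
Proof.
move=> d0 [hw pw]; split => //.
rewrite addrAC (leq_trans (msizeD_le _ _)) // geq_max pw msizeN msizeC.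
exact: leq_trans (leq_b1 _) d0.
Qed.

(** A member of degree zero would be a constant [b], giving the relation ['X_i - b]. *)
Lemma independent_homog_gt0 r (t : r.-tuple {mpoly F[n]}) i d :
  algebraically_independent t -> tnth t i \is d.-homog -> (0 < d)%N.
Proof.
move=> indep; case: d => // /dhomog_msize_leq /msize1_polyC ti.
have /indep/(congr1 (mcoeff U_(i)%MM)) :
    ('X_i - ((tnth t i)@_0%MM)%:MP) \mPo t = 0.
  by rewrite comp_mpolyB comp_mpolyXU comp_mpolyC -tnth_nth -ti subrr.
rewrite mcoeffB mcoeffX eqxx mcoeffC mnm1_eq0 mulr0 subr0 mcoeff0.
by move/eqP; rewrite oner_eq0.
Qed.

End Translation.

(** * Maps that are multiplicative on a subalgebra *)

Section PartialMorphism.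
Variables (F : fieldType) (A B : algType F) (P : A -> Prop) (phi : A -> B).
Hypothesis P1 : P 1.
Hypothesis P_linear : forall a x y, P x -> P y -> P (a *: x + y).
Hypothesis P_mul : forall x y, P x -> P y -> P (x * y).
Hypothesis phi1 : phi 1 = 1.
Hypothesis phi_linear :
  forall a x y, P x -> P y -> phi (a *: x + y) = a *: phi x + phi y.
Hypothesis phi_mul : forall x y, P x -> P y -> phi (x * y) = phi x * phi y.

(** As [phi] respects the operations only on [P], membership in [P] is carried through each
    induction. This serves both [gamma], on central elements, and [chi], on the algebra generated by
    the [D i]. *)
Lemma partial_morphism_mmap r (D : 'I_r -> A) (p : {mpoly F[r]}) :
  (forall i, P (D i)) ->
  phi (mmap (fun a => a%:A) D p) =
  \sum_(m <- msupp p) p@_m *: \prod_i phi (D i) ^+ m i.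
Proof.
move=> PD.
have P0 : P 0 by rewrite -(addNr 1) -scaleN1r; apply: P_linear.
have phi0 : phi 0 = 0.
  have := phi_linear 1 P0 P0; rewrite !scale1r addr0 => /eqP.
  by rewrite -subr_eq subrr eq_sym => /eqP.
have monP (m : 'X_{1..r}) : P (mmap1 D m) /\
    phi (mmap1 D m) = \prod_i phi (D i) ^+ m i.
  rewrite /mmap1; elim: (index_enum _) => [|i s [IH1 IH2]].
    by rewrite !big_nil.
  have [Pk phik] : P (D i ^+ m i) /\ phi (D i ^+ m i) = phi (D i) ^+ m i.
    elim: (m i) => [|k [Pk phik]]; first by rewrite !expr0.
    by rewrite !exprS phi_mul // phik; split => //; apply: P_mul.
  by rewrite !big_cons phi_mul // phik IH2; split => //; apply: P_mul.
rewrite /mmap; set s := msupp p.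
suff [] : P (\sum_(m <- s) (p@_m)%:A * mmap1 D m) /\
    phi (\sum_(m <- s) (p@_m)%:A * mmap1 D m) =
    \sum_(m <- s) p@_m *: \prod_i phi (D i) ^+ m i by [].
elim: s => [|m s [IH1 IH2]]; first by rewrite !big_nil.
have [Pm phim] := monP m.
rewrite !big_cons mulr_algl phi_linear // phim IH2; split => //.
exact: P_linear.
Qed.

End PartialMorphism.

Section CentralElements.
Variables (R : realType) (U : algType R[i]).

Lemma central_element1 : central_element (1 : U).
Proof. by move=> u; rewrite mul1r mulr1. Qed.

Lemma central_element_linear a (z z' : U) :
  central_element z -> central_element z' -> central_element (a *: z + z').
Proof.
by move=> cz cz' u; rewrite mulrDl mulrDr -scalerAl -scalerAr cz cz'.
Qed.

Lemma central_elementM (z z' : U) :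
  central_element z -> central_element z' -> central_element (z * z').
Proof. by move=> cz cz' u; rewrite -mulrA cz' mulrA cz mulrA. Qed.

Variables (r : nat) (D : 'I_r -> U).

Lemma in_generated1 : in_generated D 1.
Proof. by exists 1; rewrite [RHS](mmapC _ (in_alg U)); apply/esym/scale1r. Qed.

Lemma in_generated_linear a Z Z' :
  in_generated D Z -> in_generated D Z' -> in_generated D (a *: Z + Z').
Proof.
move=> [p ->] [q ->]; exists (a *: p + q).
by rewrite [RHS](mmapD _ (in_alg U)) (mmapZ _ (in_alg U)) mulr_algl.
Qed.

Hypothesis D_central : forall i, central_element (D i).

(** Substitution into a noncommutative algebra is multiplicative here because the [D i] are
    central. *)
Lemma in_generatedM Z Z' :
  in_generated D Z -> in_generated D Z' -> in_generated D (Z * Z').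
Proof.
move=> [p ->] [q ->]; exists (p * q).
have comm_scalar (c : R[i]) (x : U) : GRing.comm (in_alg U c) x.
  by rewrite /GRing.comm mulr_algl mulr_algr.
have [] := @commr_mmap_is_multiplicative r R[i] U D (in_alg U) => [i x|p' m m'|].
- exact/esym/D_central.
- exact: comm_scalar.
- by move=> mulD _; rewrite [RHS]mulD.
Qed.

Lemma in_generated_gen i : in_generated D (D i).
Proof. by exists 'X_i; rewrite [RHS](mmapX _ (in_alg U)) mmap1U. Qed.

End CentralElements.

(** * Functionals and linear forms in coordinates *)

Section DualBasis.
Variables (R : realType) (N : nat).
Notation g := 'rV[R]_N.

Lemma dual_ev_basis (V : {vspace g}) (l : dualC V) (j : 'I_(\dim V)) :
  dual_ev l (vbasis V)`_j = l ord0 j.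
Proof.
have freeV := basis_free (vbasisP V).
rewrite /dual_ev (bigD1 j) //= coord_free // eqxx mul1r big1 ?addr0 //.
by move=> k kj; rewrite coord_free // eq_sym (negPf kj) mul0r.
Qed.

Lemma dual_evD (V : {vspace g}) (l : dualC V) x y :
  dual_ev l (x + y) = dual_ev l x + dual_ev l y.
Proof.
rewrite /dual_ev -big_split; apply: eq_bigr => j _ /=.
by rewrite linearD rmorphD mulrDl.
Qed.

Lemma dual_evZ (V : {vspace g}) (l : dualC V) a x :
  dual_ev l (a *: x) = a%:C * dual_ev l x.
Proof.
rewrite /dual_ev mulr_sumr; apply: eq_bigr => j _ /=.
by rewrite linearZ rmorphM mulrA.
Qed.

Lemma dual_ev_sum (V : {vspace g}) (l : dualC V) (I : Type) (s : seq I) (G : I -> g) :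
  dual_ev l (\sum_(i <- s) G i) = \sum_(i <- s) dual_ev l (G i).
Proof.
elim: s => [|i s IH]; last by rewrite !big_cons dual_evD IH.
rewrite !big_nil /dual_ev big1 // => j _.
by rewrite linear0 rmorph0 mul0r.
Qed.

Lemma dual_ev0 (V : {vspace g}) x : dual_ev (0 : dualC V) x = 0.
Proof. by rewrite /dual_ev big1 // => j _; rewrite mxE mulr0. Qed.

(** For [x] in [V], this is [x] as an element of degree one of the symmetric algebra. *)
Definition linear_form (V : {vspace g}) (x : g) : SymC V :=
  \sum_(j < \dim V) (coord (vbasis V) j x)%:C *: 'X_j.

Lemma linear_form_eval (V : {vspace g}) x (l : dualC V) :
  row_eval (linear_form V x) l = dual_ev l x.
Proof.
rewrite /row_eval raddf_sum; apply: eq_bigr => j _ /=.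
by rewrite mevalZ mevalXU.
Qed.

Lemma linear_form_homog (V : {vspace g}) x : linear_form V x \is 1.-homog.
Proof.
by apply: rpred_sum => j _; apply: rpredZ; rewrite dhomogX /= mdeg1.
Qed.

End DualBasis.

(** * The Weyl group of the normalizer as a polynomial group *)

Section WeylGroup.
Variables (R : realType) (N : nat).
Notation g := 'rV[R]_N.

(** An injective linear map preserves dimension, so the image of [V] inside [V] is all of [V]. *)
Lemma linear_stable_onto (f : g -> g) (V : {vspace g}) :
  linear f -> bijective f -> (forall x, x \in V -> f x \in V) ->
  forall x, x \in V -> exists2 y, y \in V & f y = x.
Proof.
move=> linf /bij_inj injf stable x xV.
pose fl : {linear g -> g} := HB.pack f (GRing.isLinear.Build _ _ _ _ f linf).
have fE y : linfun fl y = f y by rewrite lfunE.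
have sub : (linfun fl @: V <= V)%VS.
  by apply/subvP => _ /memv_imgP[y yV ->]; rewrite fE stable.
have /eqP eqV : (linfun fl @: V == V)%VS.
  rewrite eqEdim sub limg_dim_eq ?leqnn //.
  apply/eqP; rewrite -subv0; apply/subvP => y.
  rewrite memv_cap memv_ker => /andP[_ /eqP].
  by rewrite fE -(linear0 fl) => /injf ->; rewrite mem0v.
by move: xV; rewrite -{1}eqV => /memv_imgP[y yV ->]; exists y.
Qed.

Variables (br : g -> g -> g) (G : preTopologicalGroupType).
Variables (exp : g -> G) (Ad : G -> g -> g) (G_lie : lie_group br exp Ad).

Lemma lie_group_Ad1 x : Ad 1%g x = x.
Proof.
have [_ /bij_inj inj1 _] := lg_Ad_automorphism G_lie 1%g.
by apply: inj1; rewrite -(lg_Ad_morphism G_lie) mulg1.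
Qed.

(** The map [w] is contragredient to [Ad k]: the coordinates of [w l] are the values of [l] at
    preimages of the basis vectors under [Ad k], hence linear in [l]. *)
Lemma weyl_group_of_normalizer_polynomial (K : set G) (a : {vspace g}) :
  subgroup K -> polynomial_group (weyl_group_of_normalizer Ad K (a := a)).
Proof.
move=> [K1 KM _].
have onto k : (forall x, x \in a -> Ad k x \in a) ->
    forall x, x \in a -> exists2 y, y \in a & Ad k y = x.
  by have [lin bij _] := lg_Ad_automorphism G_lie k; apply: linear_stable_onto.
(* Out of range the default value is [0], which also lies in [a]. *)
have basis_mem j : (vbasis a)`_j \in a.
  have [ja|ja] := ltnP j (\dim a); last by rewrite nth_default ?mem0v // size_tuple.
  by apply/vbasis_mem/mem_nth; rewrite size_tuple.
split.
- exists id => //; exists 1%g; split => // [x|l x _]; by rewrite lie_group_Ad1.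
- move=> w w' [k [Kk sk wk]] [k' [Kk' sk' wk']].
  exists (k * k')%g; split; first exact: KM.
    by move=> x xa; rewrite (lg_Ad_morphism G_lie) sk ?sk'.
  by move=> l x xa; rewrite (lg_Ad_morphism G_lie) /= wk ?sk' // wk'.
- move=> w [k [Kk sk wk]] l.
  (* The preimage of [l] under [w] is [l] composed with [Ad k]. *)
  exists (\row_j dual_ev l (Ad k (vbasis a)`_j)); apply/rowP => j.
  rewrite -!dual_ev_basis; have [y ya <-] := onto k sk _ (basis_mem j).
  rewrite wk // {1}/dual_ev.
  have [lin _ _] := lg_Ad_automorphism G_lie k.
  pose Adk : {linear g -> g} :=
    HB.pack (Ad k) (GRing.isLinear.Build _ _ _ _ (Ad k) lin).
  have -> : Ad k y = \sum_(i < \dim a) coord (vbasis a) i y *: Ad k (vbasis a)`_i.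
    have AdkE x : Ad k x = Adk x by [].
    rewrite {1}(coord_vbasis ya) AdkE linear_sum.
    by apply: eq_bigr => i _; rewrite linearZ.
  rewrite dual_ev_sum; apply: eq_bigr => i _.
  by rewrite mxE dual_evZ.
- move=> w [k [Kk sk wk]] j.
  have [y ya yj] := onto k sk _ (basis_mem j).
  exists (linear_form a y) => l.
  by rewrite linear_form_eval -(wk l y ya) yj dual_ev_basis.
Qed.

End WeylGroup.

(** * Evaluation at [(t;x)] as a substitution *)

Section DualJoin.
Variables (R : realType) (N : nat) (c V W : {vspace 'rV[R]_N}).

(** Linear part in [x] of the [k]-th coordinate of [dual_join c t x]; the constant part is
    [join_const t k]. *)
Definition join_form (k : 'I_(\dim c)) : SymC W :=
  linear_form W (daddv_pi W V (vbasis c)`_k).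

Definition join_const (t : dualC V) (k : 'I_(\dim c)) : R[i] :=
  dual_ev t (daddv_pi V W (vbasis c)`_k).

Lemma sym_ev_dual_join (P : SymC c) (t : dualC V) (x : dualC W) :
  sym_ev P (dual_join c t x) =
  row_eval (P \mPo [tuple join_form k + (join_const t k)%:MP | k < \dim c]) x.
Proof.
rewrite /row_eval comp_mpoly_meval; apply: meval_eq => k.
rewrite mxE tnth_mktuple mevalD mevalC -/(row_eval _ _) linear_form_eval.
exact: addrC.
Qed.

Lemma sym_ev_dual_join0 (P : SymC c) (x : dualC W) :
  sym_ev P (dual_join c (0 : dualC V) x) =
  row_eval (P \mPo [tuple join_form k | k < \dim c]) x.
Proof.
rewrite /row_eval comp_mpoly_meval; apply: meval_eq => k.
by rewrite mxE tnth_mktuple dual_ev0 add0r -/(row_eval _ _) linear_form_eval.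
Qed.

End DualJoin.

Lemma fixed_points_subgroup (R : realType) (N : nat)
    (br : 'rV[R]_N -> 'rV[R]_N -> 'rV[R]_N) (G : preTopologicalGroupType)
    (exp : 'rV[R]_N -> G) (s : G -> G) (ds : 'rV[R]_N -> 'rV[R]_N) :
  lie_group_involution br exp s ds -> subgroup (fixed_points s).
Proof.
move=> inv_s; have sM := inv_morphism inv_s.
have s1 : s 1%g = 1%g.
  by apply: (mulgI (s 1%g)); rewrite -sM !mulg1.
split=> [//|x y sx sy|x sx]; first by rewrite /fixed_points /= sM sx sy.
by apply: (mulgI x); rewrite -{1}(sx : s x = x) -sM !mulgV s1.
Qed.

Theorem mainTheorem1 (R : realType) (N : nat)
  (br : 'rV[R]_N -> 'rV[R]_N -> 'rV[R]_N)
  (G : preTopologicalGroupType)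
  (exp : 'rV[R]_N -> G) (Ad : G -> 'rV[R]_N -> 'rV[R]_N)
  (G_lie : lie_group br exp Ad)
  (G_connected : connected [set: G])
  (G_semisimple : lie_semisimple br)
  (G_center : finite_set (group_center (G := G)))
  (sigma theta : G -> G) (dsigma dtheta : 'rV[R]_N -> 'rV[R]_N)
  (sigma_involution : lie_group_involution br exp sigma dsigma)
  (H : set G) (H_open : open_subgroup_of_fixed_points sigma H)
  (theta_cartan : cartan_involution br exp theta dtheta)
  (theta_sigma : forall x, theta (sigma x) = sigma (theta x))
  (aq c c0 m : {vspace 'rV[R]_N})
  (aq_max : maximal_abelian_in_pq br dtheta dsigma aq)
  (c_cartan : cartan_subalgebra br c)
  (aq_c : (aq <= c)%VS)
  (c0_def : forall x,
     x \in c0 <-> x \in c /\ killing_orthogonal br aq x)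
  (m_def : forall x,
     x \in m <-> (forall y, y \in aq -> br x y = 0) /\
                 killing_orthogonal br aq x)
  (M : set G) (M_def : langlands_factor exp Ad aq m M)
  (U : 'I_(\dim aq) -> SymC c) (W : 'I_(\dim aq) -> SymC aq)
  (U_invariant : forall i, weyl_invariant (weyl_group br fullv (c := c)) (U i))
  (U_homogeneous : forall i, exists e : nat, U i \is e.-homog)
  (W_def : forall i (x : dualC aq),
     sym_ev (W i) x = sym_ev (U i) (dual_join c (0 : dualC c0) x))
  (W_independent : alg_independent W)
  (W_free : free_of_finite_rank_over
     (weyl_invariant (weyl_group_of_normalizer Ad (fixed_points theta) (a := aq)))
     W)
  (Ug : algType R[i]) (iota : 'rV[R]_N -> Ug)
  (Ug_enveloping : enveloping_algebra br fullv iota)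
  (pos : seq (dualC c)) (pos_system : positive_system br fullv pos)
  (gamma : Ug -> SymC c)
  (gamma_hc : harish_chandra br fullv iota pos gamma)
  (D : 'I_(\dim aq) -> Ug)
  (D_central : forall i, central_element (D i))
  (D_def : forall i, gamma (D i) = U i) :
  forall (lambda : dualC aq) (chi : Ug -> R[i]),
    character_with_values D
      (fun i => sym_ev (U i) (dual_join c (0 : dualC c0) lambda)) chi ->
  forall (d : nat) (xi : G -> 'M[R[i]]_d) (Lambda : dualC c0),
    irreducible_unitary_rep M xi ->
    infinitesimal_character br exp m xi Lambda ->
  exists lambda_xi : dualC aq,
    forall Z, in_generated D Z ->
      sym_ev (gamma Z) (dual_join c Lambda lambda_xi) = chi Z.
Proof.
move=> lambda chi chi_char d xi Lambda _ _.
set T := weyl_group_of_normalizer Ad (fixed_points theta) (a := aq).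
have gT : polynomial_group T.
  apply: (weyl_group_of_normalizer_polynomial G_lie).
  exact: fixed_points_subgroup theta_cartan.1.
pose t := [tuple W i | i < \dim aq].
have [s [e [inv_e _]]] := W_free.
(* Since [1] is invariant, it is a combination of the [e j] over the polynomials in [W]. Multiplying
   by [W i] gives another such combination, which is therefore invariant. *)
have t_invariant i : invariant_under T (tnth t i).
  apply/inv_e; have /inv_e[q q1] : invariant_under T 1.
    by move=> w l _; rewrite /row_eval !meval1.
  exists (fun j => 'X_i * q j); rewrite -[LHS]mulr1 {1}q1 mulr_sumr.
  apply: eq_bigr => j _.
  by rewrite rmorphM /= comp_mpolyXU -tnth_nth mulrA.
have alg := variable_algebraic gT W_independent t_invariant inv_e.
have /choice[dg dgU] := U_homogeneous.
pose v i := sym_ev (U i) (dual_join c (0 : dualC c0) lambda).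
pose L := @join_form R N c c0 aq.
(* The polynomial [U_i(Lambda; x)] in [x]. *)
pose shifted i := U i \mPo [tuple L k + (join_const aq Lambda k)%:MP | k < \dim c].
pose f := [tuple shifted i - (v i)%:MP | i < \dim aq].
have WE i : W i = U i \mPo [tuple L k | k < \dim c].
  by apply: row_eval_inj => x; rewrite -sym_ev_dual_join0 -W_def.
have lead i : leading_form (shifted i) (W i) (dg i).
  rewrite WE; apply: leading_form_translate; first exact: dgU.
  by move=> k; apply: linear_form_homog.
have dg0 i : (0 < dg i)%N.
  apply: (independent_homog_gt0 W_independent (i := i)).
  by rewrite tnth_mktuple; case: (lead i).
have [|a fa] := leading_forms_common_zero (f := f) _ dg0 W_independent alg.
  by move=> i; rewrite !tnth_mktuple; apply: leading_form_subC.
pose lxi : dualC aq := \row_j a j.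
have Uv i : sym_ev (U i) (dual_join c Lambda lxi) = v i.
  rewrite sym_ev_dual_join -/(shifted i).
  have := fa i; rewrite tnth_mktuple mevalB mevalC => /eqP.
  rewrite subr_eq0 => /eqP <-; apply: meval_eq => j; exact: mxE.
exists lxi => Z [p ->].
rewrite (partial_morphism_mmap (@central_element1 _ Ug)
  (@central_element_linear _ Ug) (@central_elementM _ Ug)
  (hc_one gamma_hc) (hc_linear gamma_hc) (hc_mul gamma_hc) p D_central).
(* The field is regarded as an algebra over itself to make it a target for [chi]. *)
rewrite (@partial_morphism_mmap _ _ R[i]^o _ chi (in_generated1 D)
  (@in_generated_linear _ _ _ D) (in_generatedM D_central)
  (chi_one chi_char) (chi_linear chi_char) (chi_mul chi_char) _ D p
  (in_generated_gen D)).
rewrite /sym_ev raddf_sum; apply: eq_bigr => mu _ /=.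
rewrite mevalZ rmorph_prod; congr (_ * _); apply: eq_bigr => i _.
by rewrite rmorphXn /= D_def (chi_gen chi_char); congr (_ ^+ _); apply: Uv.
Qed.
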